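(* Let $D$ be a predilator such that $\overline D(\omega^2)$ is well-founded. Then at least one of the following holds: (i) $\mathsf{RCA}_0\vDash_\omega\text{``$D$ is a dilator''}$; (ii) $\mathsf{RCA}_0\vDash_\omega\big(\text{``$D$ is a dilator''}\to\Pi^0_2\textsf{-}\mathsf{TI}^\star\big)$.
   Context: Linear orders have underlying set $\subseteq\mathbb N$. A (coded) predilator is a monotone functor $D$ ($f\le g$ pointwise implies $D(f)\le D(g)$) from the category of finite orders $n=\{0,\ldots,n-1\}$ with embeddings to the category of linear orders with embeddings, with a natural transformation $\mathrm{supp}:D\Rightarrow[\cdot]^{<\omega}$ to the finite-powerset functor such that for every $f:m\to n$, every $\tau\in D(n)$ with $\mathrm{supp}_n(\tau)\subseteq\mathrm{rng}(f)$ lies in $\mathrm{rng}(D(f))$; it is coded by a subset of $\mathbb N$. For a finite order $a$ let $\mathrm{en}_a:|a|\to a$ be its increasing enumeration and for embeddings $f:a\to b$ of finite orders let $|f|$ satisfy $\mathrm{en}_b\circ|f|=f\circ\mathrm{en}_a$. For a linear order $\alpha$, $\overline D(\alpha)$ is the set of pairs $(\sigma,a)$ with $a\subseteq\alpha$ finite, $\sigma\in D(|a|)$, $\mathrm{supp}_{|a|}(\sigma)=\{0,\ldots,|a|-1\}$, ordered by $(\sigma,a)\le(\tau,b)$ iff $D(|\iota_a|)(\sigma)\le D(|\iota_b|)(\tau)$ (inclusions into $a\cup b$). $D$ is a dilator if $\overline D(\alpha)$ is well-founded for all well orders $\alpha$; ``$D$ is a dilator'' is the corresponding second-order statement. $\omega^2$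 is the order of pairs $\omega\cdot m+n$ compared lexicographically with $m$ first. For a linear order $\alpha$, $2^\alpha$ is the order of terms $2^{x_{n-1}}+\ldots+2^{x_0}$ with $x_0<\ldots<x_{n-1}$ in $\alpha$, compared lexicographically with the largest exponent taking precedence. $\Pi^0_2\textsf{-}\mathsf{TI}^\star$ is the statement: for every linear order $\alpha$ with $2^\alpha$ well-founded, induction along $\alpha$ holds for all $\Pi^0_2$-formulas with parameters. $\mathsf T\vDash_\omega\varphi(X_1,\ldots,X_n)$ means there is $Y\subseteq\mathbb N$ with $\mathcal M\vDash\varphi(X_1,\ldots,X_n)$ for every $\omega$-model $\mathcal M\vDash\mathsf T$ containing $X_1,\ldots,X_n,Y$. *)

(* Defs.v *)
From mathcomp Require Import all_boot.
From mathcomp Require Import boolp classical_sets.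

Set Implicit Arguments.
Unset Strict Implicit.
Unset Printing Implicit Defensive.

Local Open Scope classical_set_scope.
Local Open Scope nat_scope.

(* The usual pairing of second-order arithmetic: injective, not surjective. *)
Definition npair (i j : nat) : nat := (i + j) ^ 2 + i.

Definition code (s : seq nat) : nat := CodeSeq.code s.

(* An omega-model is given by its collection of sets: the number part is the
   standard one. Satisfaction of a second-order statement in M means that its
   set quantifiers are relativized to M. [setT] is the full model. *)
Definition omega_model := set (set nat).

(* A function belongs to M if its graph does. *)
Definition fun_in (M : omega_model) (f : nat -> nat) : Prop :=
  M (range (fun i => npair i (f i))).

Inductive term : Type :=
| TVar of nat
| TZero
| TOne
| TAdd of term & term
| TMul of term & term.

(* Formulas without set quantifiers, with free number and set variables. Number
   variables are de Bruijn indices; the bound of a bounded quantifier lies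
   outside the scope of that quantifier. *)
Inductive formula : Type :=
| FEq of term & term
| FLt of term & term
| FIn of term & nat
| FNot of formula
| FAnd of formula & formula
| FOr of formula & formula
| FImp of formula & formula
| FAllB of term & formula
| FExB of term & formula
| FAll of formula
| FEx of formula.

Definition env_cons (x : nat) (e : nat -> nat) : nat -> nat :=
  fun k => if k is k'.+1 then e k' else x.

Fixpoint teval (e : nat -> nat) (t : term) : nat :=
  match t with
  | TVar k => e k
  | TZero => 0
  | TOne => 1
  | TAdd t1 t2 => teval e t1 + teval e t2
  | TMul t1 t2 => teval e t1 * teval e t2
  end.

Fixpoint sat (e : nat -> nat) (E : nat -> set nat) (phi : formula) : Prop :=
  match phi with
  | FEq t1 t2 => teval e t1 = teval e t2
  | FLt t1 t2 => teval e t1 < teval e t2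
  | FIn t k => E k (teval e t)
  | FNot p => ~ sat e E p
  | FAnd p q => sat e E p /\ sat e E q
  | FOr p q => sat e E p \/ sat e E q
  | FImp p q => sat e E p -> sat e E q
  | FAllB t p => forall x, x < teval e t -> sat (env_cons x e) E p
  | FExB t p => exists2 x, x < teval e t & sat (env_cons x e) E p
  | FAll p => forall x, sat (env_cons x e) E p
  | FEx p => exists x, sat (env_cons x e) E p
  end.

Fixpoint bounded (phi : formula) : bool :=
  match phi with
  | FEq _ _ | FLt _ _ | FIn _ _ => true
  | FNot p | FAllB _ p | FExB _ p => bounded p
  | FAnd p q | FOr p q | FImp p q => bounded p && bounded q
  | FAll _ | FEx _ => false
  end.

Definition is_Sigma01 (phi : formula) : Prop :=
  exists2 theta, bounded theta & phi = FEx theta.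
Definition is_Pi01 (phi : formula) : Prop :=
  exists2 theta, bounded theta & phi = FAll theta.
Definition is_Pi02 (phi : formula) : Prop :=
  exists2 theta, bounded theta & phi = FAll (FEx theta).

Definition Sigma01_induction (M : omega_model) : Prop :=
  forall phi e E, is_Sigma01 phi -> (forall k, M (E k)) ->
    sat (env_cons 0 e) E phi ->
    (forall n, sat (env_cons n e) E phi -> sat (env_cons n.+1 e) E phi) ->
    forall n, sat (env_cons n e) E phi.

Definition Delta01_comprehension (M : omega_model) : Prop :=
  forall phi psi e E, is_Sigma01 phi -> is_Pi01 psi -> (forall k, M (E k)) ->
    (forall n, sat (env_cons n e) E phi <-> sat (env_cons n e) E psi) ->
    exists2 X, M X & forall n, X n <-> sat (env_cons n e) E phi.

(* The basic axioms on 0, 1, +, *, < only concern the standard number part. *)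
Definition RCA0 (M : omega_model) : Prop :=
  M !=set0 /\ Sigma01_induction M /\ Delta01_comprehension M.

(* T |=_omega phi(X) *)
Definition omega_entails (T : omega_model -> Prop)
    (phi : omega_model -> set nat -> Prop) (X : set nat) : Prop :=
  exists Y : set nat, forall M : omega_model, T M -> M X -> M Y -> phi M X.

(* An order is given by its reflexive relation, with underlying set
   {x | R x x}. *)
Notation nrel := (nat -> nat -> Prop).

Definition strict (R : nrel) : nrel := fun x y => R x y /\ x <> y.

Definition linear_order (R : nrel) : Prop :=
  [/\ forall x y, R x y -> R x x /\ R y y,
      forall x y, R x y -> R y x -> x = y,
      forall x y z, R x y -> R y z -> R x z
    & forall x y, R x x -> R y y -> R x y \/ R y x].

Definition coded_order (A : set nat) : nrel := fun x y => A (npair x y).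

(* M |= "R is well-founded" *)
Definition wf_in (M : omega_model) (R : nrel) : Prop :=
  ~ exists2 f : nat -> nat, fun_in M f & forall i, strict R (f i.+1) (f i).

(* The list a is strictly increasing in R; such lists serve as codes of the
   finite suborders of R, a being identified with its enumeration en_a. *)
Definition increasing (R : nrel) (a : seq nat) : Prop :=
  uniq a /\ forall i j, i <= j -> j < size a -> R (nth 0 a i) (nth 0 a j).

(* Here omega * m + n is coded by npair m n. *)
Definition omega_squared : nrel := fun u v =>
  exists m n m' n', [/\ u = npair m n, v = npair m' n' &
    m < m' \/ m = m' /\ n <= n'].

Fixpoint lex (R : nrel) (s t : seq nat) : Prop :=
  match s, t with
  | [::], _ => True
  | _ :: _, [::] => False
  | x :: s', y :: t' => strict R x y \/ x = y /\ lex R s' t'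
  end.

(* The term 2^{x_(n-1)} + ... + 2^{x_0} is coded by [:: x_(n-1); ...; x_0]. *)
Definition exp2 (R : nrel) : nrel := fun u v =>
  exists s t, [/\ u = code s, v = code t,
    increasing R (rev s), increasing R (rev t) & lex R s t].

Definition Pi02_TI_star (M : omega_model) : Prop :=
  forall A : set nat, M A -> linear_order (coded_order A) ->
    wf_in M (exp2 (coded_order A)) ->
  forall phi e E, is_Pi02 phi -> (forall k, M (E k)) ->
    (forall x, coded_order A x x ->
      (forall y, strict (coded_order A) y x -> sat (env_cons y e) E phi) ->
      sat (env_cons x e) E phi) ->
    forall x, coded_order A x x -> sat (env_cons x e) E phi.

(* An embedding f : {0,...,m-1} -> {0,...,n-1} is the list of its values, which
   is also the increasing list of the elements of its range. *)
Definition emb (m n : nat) (f : seq nat) : Prop :=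
  [/\ size f = m, sorted ltn f & all (gtn n) f].

Definition app (f : seq nat) (i : nat) : nat := nth 0 f i.

(* A set D codes: the order on D(n); the graph of D(f) for f into n; the graph
   of supp_n, with finite subsets of n as increasing lists. *)
Definition D_le (D : set nat) (n : nat) : nrel :=
  fun s t => D (npair 0 (npair n (npair s t))).
Definition D_map (D : set nat) (n : nat) (f : seq nat) : nrel :=
  fun s t => D (npair 1 (npair n (npair (code f) (npair s t)))).
Definition D_supp (D : set nat) (n s : nat) (a : seq nat) : Prop :=
  D (npair 2 (npair n (npair s (code a)))).

Definition embedding_graph (R S F : nrel) : Prop :=
  [/\ forall s, R s s -> exists t, F s t,
      forall s t, F s t -> R s s /\ S t t,
      forall s t t', F s t -> F s t' -> t = t'
    & forall s s' t t', F s t -> F s' t' -> (R s s' <-> S t t')].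

Record predilator (D : set nat) : Prop := Predilator {
  D_order : forall n, linear_order (D_le D n);
  D_emb : forall m n f, emb m n f ->
    embedding_graph (D_le D m) (D_le D n) (D_map D n f);
  D_id : forall n s, D_le D n s s -> D_map D n (iota 0 n) s s;
  D_comp : forall m n k f g r s t, emb m n f -> emb n k g ->
    D_map D n f r s -> D_map D k g s t -> D_map D k (map (app g) f) r t;
  D_mono : forall m n f g s t t', emb m n f -> emb m n g ->
    (forall i, i < m -> app f i <= app g i) ->
    D_map D n f s t -> D_map D n g s t' -> D_le D n t t';
  D_supp_total : forall n s, D_le D n s s -> exists a, D_supp D n s a;
  D_supp_fset : forall n s a, D_supp D n s a ->
    [/\ D_le D n s s, sorted ltn a & all (gtn n) a];
  D_supp_fun : forall n s a b, D_supp D n s a -> D_supp D n s b -> a = b;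
  D_supp_nat : forall m n f s t a, emb m n f -> D_map D n f s t ->
    D_supp D m s a -> D_supp D n t (map (app f) a);
  D_supp_cond : forall m n f t a, emb m n f -> D_supp D n t a ->
    {subset a <= f} -> exists s, D_map D n f s t
}.

(* The pair (s, a) belongs to Dbar(R). *)
Definition Dbar_elt (D : set nat) (R : nrel) (s : nat) (a : seq nat) : Prop :=
  [/\ increasing R a, D_le D (size a) s s & D_supp D (size a) s (iota 0 (size a))].

(* |iota| for the inclusion iota of a into c: the i-th element of a is the
   j-th element of c, where j is the i-th entry of this list. *)
Definition incl (c a : seq nat) : seq nat := [seq index x c | x <- a].

(* (s, a) is coded by npair s (code a), and c is the union of a and b. *)
Definition Dbar (D : set nat) (R : nrel) : nrel := fun u v =>
  exists s a t b, [/\ u = npair s (code a), v = npair t (code b),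
    Dbar_elt D R s a, Dbar_elt D R t b &
    exists c s' t', [/\ increasing R c, c =i a ++ b,
      D_map D (size c) (incl c a) s s', D_map D (size c) (incl c b) t t'
      & D_le D (size c) s' t']].

Definition dilator_in (M : omega_model) (D : set nat) : Prop :=
  predilator D /\
  forall A : set nat, M A -> linear_order (coded_order A) ->
    wf_in M (coded_order A) -> wf_in M (Dbar D (coded_order A)).

(* Main.v *)
(** Fix a predilator. For terms in which some variables are frozen, write [X << Y]
    if [X] lies below [Y] for all placements that agree on the frozen variables.
    Among the other variables of a single term, one has precedence over all the
    rest; and two terms that are incomparable for [<<] are compared according to
    their leading variables.

    Consider a descending sequence in [Dbar alpha] that lies in an omega-model in
    which [alpha] is well-founded. Well-foundedness of [Dbar omega^2] excludes
    infinite [<<]-chains, since the frozen variables can be put at limit points of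
    [omega^2] and the others in the gaps. Hence the leading variables of the
    sequence are eventually weakly decreasing in [alpha] and thus eventually
    constant. Freezing this constant and iterating, one gets an infinite list of
    more and more subordinate variables: a path through the predilator. If there
    is no path, alternative (i) holds.

    Conversely, a path yields alternative (ii). Let [2^alpha] be well-founded in
    the model and assume that induction for a Pi02-formula fails. Search for an
    infinite descending sequence of counterexamples in [alpha] by finite
    approximations. Sums of powers [2^y] of the points [y] found so far form a
    dense set, in which the variables of the path can be placed, whatever their
    order. A further component counts the changes of the approximation downwards.
    The resulting order is well-founded in the model, but substituting the
    approximations into the path gives a descending sequence in its image under
    the predilator.

    The set [Y] of [omega_entails] only has to make constructions available in the
    model: any functional with a finite-use property is computable from a table
    of its finite uses. *)

Require Import Defs.
From mathcomp Require Import all_boot zify.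
From mathcomp Require Import boolp classical_sets.

Set Implicit Arguments.
Unset Strict Implicit.
Unset Printing Implicit Defensive.

(** * Comparison of terms *)

Lemma npair_inj i j i' j' : npair i j = npair i' j' -> i = i' /\ j = j'.
Proof. rewrite /npair => h; have: i + j = i' + j' by nia. nia. Qed.

Lemma code_inj : injective code.
Proof. exact: can_inj CodeSeq.codeK. Qed.

Lemma nth_app f a i : i < size a -> nth 0 (map (app f) a) i = nth 0 f (nth 0 a i).
Proof. by move=> hi; rewrite (nth_map 0). Qed.

Lemma sorted_nth_lt a i j : sorted ltn a -> i < j -> j < size a ->
  nth 0 a i < nth 0 a j.
Proof.
move=> sa ij ja; apply: (sorted_ltn_nth ltn_trans) => //; rewrite inE //.
exact: ltn_trans ij ja.
Qed.

Lemma nth_sorted_ltn a :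
  (forall i j, i < j -> j < size a -> nth 0 a i < nth 0 a j) -> sorted ltn a.
Proof.
move=> h; apply/(sortedP 0) => i hi; exact: h.
Qed.

Lemma sorted_ltn_leq a i j : sorted ltn a -> i < size a -> j < size a ->
  (nth 0 a i <= nth 0 a j) = (i <= j).
Proof.
move=> sa hi hj; case: (leqP i j) => ij.
  by move: ij; rewrite leq_eqVlt => /orP[/eqP->|ij]; rewrite ?leqnn // ltnW // sorted_nth_lt.
by apply/negbTE; rewrite -ltnNge sorted_nth_lt.
Qed.

Lemma sorted_map_app n k f a : emb n k f -> sorted ltn a -> all (gtn n) a ->
  sorted ltn (map (app f) a) /\ all (gtn k) (map (app f) a).
Proof.
move=> [sf srt /allP fk] sa /allP an; split.
  apply: nth_sorted_ltn => i j ij; rewrite size_map => ja.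
  rewrite !nth_app //; last exact: ltn_trans ij ja.
  apply: sorted_nth_lt => //; first exact: sorted_nth_lt.
  by rewrite sf; apply: an; apply: mem_nth.
apply/allP => x /mapP[y /an /= yn ->]; apply: fk; apply: mem_nth; by rewrite sf.
Qed.

Lemma emb_iota n k : n <= k -> emb n k (iota 0 n).
Proof.
move=> nk; split; rewrite ?size_iota ?iota_ltn_sorted //.
by apply/allP => x; rewrite mem_iota /=; lia.
Qed.

Lemma map_app_iota n a : all (gtn n) a -> map (app (iota 0 n)) a = a.
Proof.
move=> /allP an; rewrite -[RHS]map_id; apply/eq_in_map => x /an /= xn.
by rewrite /app nth_iota.
Qed.

Lemma map_app_id f : map (app f) (iota 0 (size f)) = f.
Proof. by rewrite -/(mkseq (app f) (size f)) mkseq_nth. Qed.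

Definition max_list (a : seq nat) := (foldr maxn 0 a).+1.

Lemma all_max_list a : all (gtn (max_list a)) a.
Proof.
apply/allP => x; rewrite /max_list /=; elim: a => //= y a ih.
by rewrite inE => /orP[/eqP->|/ih]; lia.
Qed.

Lemma all_gtn_leq n k a : n <= k -> all (gtn n) a -> all (gtn k) a.
Proof. by move=> nk; apply: sub_all => x /= xn; apply: leq_trans nk. Qed.

(** * Terms with natural numbers as variables *)

Section Terms.
Variables (D : set nat) (hD : predilator D).

(* The term [s(x_0 < ... < x_(m-1))] with full support, its variables being
   given the natural numbers [g]. *)
Definition tm (s : nat) (g : seq nat) : Prop :=
  [/\ sorted ltn g, D_le D (size g) s s &
      D_supp D (size g) s (iota 0 (size g))].

(** Both terms are evaluated in a common [D(n)]; by [tle_at] the choice of [n] is immaterial. *)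
Definition tle s g t h : Prop :=
  exists n s' t', [/\ all (gtn n) g, all (gtn n) h,
    D_map D n g s s', D_map D n h t t' & D_le D n s' t'].

Lemma tm_sorted s g : tm s g -> sorted ltn g.
Proof. by case. Qed.

Lemma tm_emb s g n : tm s g -> all (gtn n) g -> emb (size g) n g.
Proof. by case. Qed.

Lemma tm_val n s g : tm s g -> all (gtn n) g -> exists s', D_map D n g s s'.
Proof.
move=> ts gn; have [tot _ _ _] := D_emb hD (tm_emb ts gn).
by case: ts => _ ss _; apply: tot.
Qed.

Lemma tm_map s g n k f : tm s g -> all (gtn n) g -> emb n k f ->
  tm s (map (app f) g).
Proof.
move=> [sg ss us] gn ef; rewrite /tm size_map; split=> //.
by have [] := sorted_map_app ef sg gn.
Qed.

Lemma tle_emb_at n k f s g t h s' t' s2 t2 : tm s g -> tm t h ->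
  all (gtn n) g -> all (gtn n) h -> emb n k f ->
  D_map D n g s s' -> D_map D n h t t' ->
  D_map D k (map (app f) g) s s2 -> D_map D k (map (app f) h) t t2 ->
  (D_le D n s' t' <-> D_le D k s2 t2).
Proof.
move=> ts tt gn hn ef ms mt ms2 mt2.
have [tot rng fn ord] := D_emb hD ef.
have [_ rngs _ _] := D_emb hD (tm_emb ts gn).
have [_ rngt _ _] := D_emb hD (tm_emb tt hn).
have [s3 m3] := tot _ (proj2 (rngs _ _ ms)).
have [t3 n3] := tot _ (proj2 (rngt _ _ mt)).
have es : s2 = s3.
  have [_ _ fs _] := D_emb hD (tm_emb (tm_map ts gn ef)
    (proj2 (sorted_map_app ef (tm_sorted ts) gn))).
  by apply: fs ms2 _; apply: (D_comp hD (tm_emb ts gn) ef ms).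
have et : t2 = t3.
  have [_ _ fs _] := D_emb hD (tm_emb (tm_map tt hn ef)
    (proj2 (sorted_map_app ef (tm_sorted tt) hn))).
  by apply: fs mt2 _; apply: (D_comp hD (tm_emb tt hn) ef mt).
by rewrite es et; apply: ord.
Qed.

(** Two bounds embed as initial segments into their maximum, and [D] turns these inclusions into
    order embeddings. *)
Lemma tle_at n s g t h s' t' : tm s g -> tm t h ->
  all (gtn n) g -> all (gtn n) h -> D_map D n g s s' -> D_map D n h t t' ->
  (tle s g t h <-> D_le D n s' t').
Proof.
move=> ts tt gn hn ms mt; split; last by move=> le; exists n, s', t'.
move=> [k [s2 [t2 [gk hk ms2 mt2 le]]]].
pose N := maxn n k.
have nN : n <= N by rewrite leq_maxl.
have kN : k <= N by rewrite leq_maxr.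
have [s3 ms3] := tm_val ts (all_gtn_leq nN gn).
have [t3 mt3] := tm_val tt (all_gtn_leq nN hn).
rewrite (tle_emb_at (s2 := s3) (t2 := t3) ts tt gn hn (emb_iota nN) ms mt)
  ?map_app_iota //.
by rewrite -(tle_emb_at (s2 := s3) (t2 := t3) ts tt gk hk (emb_iota kN) ms2 mt2)
  ?map_app_iota //.
Qed.

Lemma tle_emb n k f s g t h : tm s g -> tm t h ->
  all (gtn n) g -> all (gtn n) h -> emb n k f ->
  (tle s g t h <-> tle s (map (app f) g) t (map (app f) h)).
Proof.
move=> ts tt gn hn ef.
have [s' ms] := tm_val ts gn; have [t' mt] := tm_val tt hn.
have gk := proj2 (sorted_map_app ef (tm_sorted ts) gn).
have hk := proj2 (sorted_map_app ef (tm_sorted tt) hn).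
have [s2 ms2] := tm_val (tm_map ts gn ef) gk.
have [t2 mt2] := tm_val (tm_map tt hn ef) hk.
rewrite (tle_at ts tt gn hn ms mt) (tle_emb_at ts tt gn hn ef ms mt ms2 mt2).
by rewrite (tle_at (tm_map ts gn ef) (tm_map tt hn ef) gk hk ms2 mt2).
Qed.

Lemma tm_val2 s g t h : tm s g -> tm t h -> exists n s' t',
  [/\ all (gtn n) g, all (gtn n) h, D_map D n g s s' & D_map D n h t t'].
Proof.
move=> ts tt; pose n := maxn (max_list g) (max_list h).
have gn : all (gtn n) g by apply: all_gtn_leq (all_max_list _); rewrite leq_maxl.
have hn : all (gtn n) h by apply: all_gtn_leq (all_max_list _); rewrite leq_maxr.
have [s' ms] := tm_val ts gn; have [t' mt] := tm_val tt hn.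
by exists n, s', t'.
Qed.

Lemma tm_dom n s g s' : tm s g -> all (gtn n) g -> D_map D n g s s' ->
  D_le D n s' s' /\ D_supp D n s' g.
Proof.
move=> ts gn ms; have eg := tm_emb ts gn.
have [_ rng _ _] := D_emb hD eg; split; first by have [] := rng _ _ ms.
by have [_ _ us] := ts; have := D_supp_nat hD eg ms us; rewrite map_app_id.
Qed.

Lemma tle_total s g t h : tm s g -> tm t h -> tle s g t h \/ tle t h s g.
Proof.
move=> ts tt; have [n [s' [t' [gn hn ms mt]]]] := tm_val2 ts tt.
rewrite (tle_at ts tt gn hn ms mt) (tle_at tt ts hn gn mt ms).
have [_ _ _ tot] := D_order hD n.
by apply: tot; [have [] := tm_dom ts gn ms | have [] := tm_dom tt hn mt].
Qed.

Lemma tle_refl s g : tm s g -> tle s g s g.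
Proof. by move=> ts; have [] := tle_total ts ts. Qed.

(** The support of the value of a term with full support is its list of variables, so equal values
    have equal variables; then [D(g)] reflects the order. *)
Lemma tle_anti s g t h : tm s g -> tm t h -> tle s g t h -> tle t h s g ->
  s = t /\ g = h.
Proof.
move=> ts tt; have [n [s' [t' [gn hn ms mt]]]] := tm_val2 ts tt.
rewrite (tle_at ts tt gn hn ms mt) (tle_at tt ts hn gn mt ms) => l1 l2.
have [_ anti _ _] := D_order hD n.
have e := anti _ _ l1 l2; subst t'.
have eg : g = h.
  have [_ us] := tm_dom ts gn ms; have [_ ut] := tm_dom tt hn mt.
  exact: (D_supp_fun hD us ut).
subst h; split=> //.
have [_ _ _ ord] := D_emb hD (tm_emb ts gn).
have [_ anti' _ _] := D_order hD (size g).
by apply: anti'; apply/(ord _ _ _ _ ms mt) || apply/(ord _ _ _ _ mt ms).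
Qed.

Lemma tle_trans s g t h r k : tm s g -> tm t h -> tm r k ->
  tle s g t h -> tle t h r k -> tle s g r k.
Proof.
move=> ts tt tr; have [n [s' [t' [gn hn ms mt]]]] := tm_val2 ts tt.
pose N := maxn n (max_list k).
have nN : n <= N by rewrite leq_maxl.
have kN : all (gtn N) k by apply: all_gtn_leq (all_max_list _); rewrite leq_maxr.
move: (all_gtn_leq nN gn) (all_gtn_leq nN hn) => gN hN.
have [s2 ms2] := tm_val ts gN; have [t2 mt2] := tm_val tt hN.
have [r2 mr2] := tm_val tr kN.
rewrite (tle_at ts tt gN hN ms2 mt2) (tle_at tt tr hN kN mt2 mr2).
rewrite (tle_at ts tr gN kN ms2 mr2).
have [_ _ tra _] := D_order hD N; exact: tra.
Qed.

(** Monotonicity of the functor enters the argument only here. *)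
Lemma tle_mono s g h : tm s g -> tm s h -> size g = size h ->
  (forall i, i < size g -> nth 0 g i <= nth 0 h i) -> tle s g s h.
Proof.
move=> ts tt e le; have [n [s' [t' [gn hn ms mt]]]] := tm_val2 ts tt.
rewrite (tle_at ts tt gn hn ms mt).
have eh := tm_emb tt hn; rewrite -e in eh.
exact: (D_mono hD (tm_emb ts gn) eh le ms mt).
Qed.

Lemma tlt_le s g t h : tm s g -> tm t h -> ~ tle t h s g -> tle s g t h.
Proof. by move=> ts tt nle; have [] := tle_total ts tt. Qed.

End Terms.

(** * Comparison over arbitrary linear orders *)

Lemma linear_leq : linear_order (fun x y : nat => x <= y).
Proof. by split=> // *; lia. Qed.

(** The relative position of [a] and [b] in [R] is copied by [g] and [h]. Comparisons in [Dbar R]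
    depend only on this pattern, so they can be made with natural numbers. *)
Definition pat (R : nat -> nat -> Prop) (a b g h : seq nat) : Prop :=
  [/\ size a = size g, size b = size h &
   forall i j, i < size a -> j < size b ->
     (R (nth 0 a i) (nth 0 b j) <-> nth 0 g i <= nth 0 h j) /\
     (R (nth 0 b j) (nth 0 a i) <-> nth 0 h j <= nth 0 g i)].

Section Patterns.
Variable R : nat -> nat -> Prop.
Hypothesis hR : linear_order R.

Lemma increasing_refl a i : increasing R a -> i < size a ->
  R (nth 0 a i) (nth 0 a i).
Proof. by move=> [_ h] hi; apply: h. Qed.

Lemma increasing_le a i j : increasing R a -> i < size a -> j < size a ->
  (R (nth 0 a i) (nth 0 a j) <-> i <= j).
Proof.
move=> [u h] hi hj; split; last by move=> ij; apply: h.
move=> r; rewrite leqNgt; apply/negP => ji.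
have [_ anti _ _] := hR; have e := anti _ _ r (h _ _ (ltnW ji) hi).
by move/eqP: e; rewrite nth_uniq //; lia.
Qed.

Lemma pat_emb c a b g h n : increasing R c -> c =i a ++ b ->
  increasing R a -> increasing R b -> sorted ltn g -> sorted ltn h ->
  pat R a b g h -> all (gtn n) g -> all (gtn n) h ->
  exists f, [/\ emb (size c) n f, map (app f) (incl c a) = g &
                map (app f) (incl c b) = h].
Proof.
move=> ic ec ia ib sg sh [sag sbh pt] gn hn.
have [uc _] := ic; have [ua _] := ia; have [ub _] := ib.
have [_ anti _ _] := hR.
(* Each element of the union goes to the number representing it; where [a] and [b] overlap, the
   pattern makes the two candidates equal. *)
pose v x := if x \in a then nth 0 g (index x a) else nth 0 h (index x b).
have va i : i < size a -> v (nth 0 a i) = nth 0 g i.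
  by move=> hi; rewrite /v mem_nth // index_uniq.
have vb j : j < size b -> v (nth 0 b j) = nth 0 h j.
  move=> hj; rewrite /v; case: ifP => [xa|_]; last by rewrite index_uniq.
  have ix : index (nth 0 b j) a < size a by rewrite index_mem.
  have [p1 p2] := pt _ _ ix hj; rewrite !nth_index // in p1 p2.
  have rb := increasing_refl ib hj.
  by apply/eqP; rewrite eqn_leq; apply/andP; split; [apply/p1|apply/p2].
have vle x y : x \in c -> y \in c -> (R x y <-> v x <= v y).
  rewrite !ec !mem_cat => /orP[]/(nthP 0)[i hi <-] /orP[]/(nthP 0)[j hj <-].
  - by rewrite increasing_le // !va // sorted_ltn_leq // -sag.
  - by rewrite va // vb //; have [] := pt _ _ hi hj.
  - by rewrite va // vb //; have [] := pt _ _ hj hi.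
  - by rewrite increasing_le // !vb // sorted_ltn_leq // -sbh.
exists [seq v x | x <- c]; split.
- split; first by rewrite size_map.
    apply: nth_sorted_ltn => i j ij; rewrite size_map => hj.
    have hi := ltn_trans ij hj.
    rewrite !(nth_map 0) // ltnNge; apply/negP => /vle.
    rewrite !mem_nth // => /(_ isT isT) /increasing_le => /(_ ic hj hi).
    by rewrite leqNgt ij.
  apply/allP => y /mapP[x xc ->]; move: xc; rewrite ec mem_cat.
  case/orP=> /(nthP 0)[i hi <-]; rewrite ?va ?vb //.
    by apply: (allP gn); rewrite mem_nth // -sag.
  by apply: (allP hn); rewrite mem_nth // -sbh.
- apply: (@eq_from_nth _ 0); rewrite ?size_map // => i hi.
  have xc : nth 0 a i \in c by rewrite ec mem_cat mem_nth.
  rewrite nth_app ?size_map // (nth_map 0) // (nth_map 0) ?index_mem //.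
  by rewrite nth_index // va.
- apply: (@eq_from_nth _ 0); rewrite ?size_map // => i hi.
  have xc : nth 0 b i \in c by rewrite ec mem_cat mem_nth // orbT.
  rewrite nth_app ?size_map // (nth_map 0) // (nth_map 0) ?index_mem //.
  by rewrite nth_index // vb.
Qed.

Lemma increasing_union a b : increasing R a -> increasing R b ->
  exists2 c, increasing R c & c =i a ++ b.
Proof.
move=> ia ib; have [_ _ tra tot] := hR.
pose r := [rel x y | `[<R x y>]].
exists (sort r (undup (a ++ b))); last by move=> x; rewrite mem_sort mem_undup.
have fld x : x \in undup (a ++ b) -> R x x.
  by rewrite mem_undup mem_cat => /orP[]/(nthP 0)[i hi <-]; apply: increasing_refl.
have srt : sorted r (sort r (undup (a ++ b))).
  apply: (@sort_sorted_in _ (mem (undup (a ++ b)))); last by apply/allP.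
  move=> x y /fld xx /fld yy /=.
  by case: (tot _ _ xx yy) => h; apply/orP; [left|right]; apply/asboolP.
split=> [|i j ij hj]; first by rewrite sort_uniq undup_uniq.
have tr : transitive r.
  by move=> y x z /= /asboolP h1 /asboolP h2; apply/asboolP; apply: tra h1 h2.
move: ij; rewrite leq_eqVlt => /orP[/eqP ->|ij].
  by apply: fld; rewrite -(mem_sort r) mem_nth.
by apply/asboolP; apply: (sorted_ltn_nth tr 0 srt) => //;
  rewrite inE //; apply: ltn_trans hj.
Qed.

Lemma pat_incl c a b : increasing R c -> {subset a <= c} -> {subset b <= c} ->
  pat R a b (incl c a) (incl c b).
Proof.
move=> ic sa sb; split; rewrite ?size_map // => i j hi hj.
rewrite !(nth_map 0) //.
have ac : nth 0 a i \in c by apply: sa; rewrite mem_nth.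
have bc : nth 0 b j \in c by apply: sb; rewrite mem_nth.
split; rewrite -[in X in X <-> _](nth_index 0 ac) -[in X in X <-> _](nth_index 0 bc);
  by rewrite increasing_le ?index_mem.
Qed.

Lemma sorted_incl c a : increasing R c -> {subset a <= c} -> increasing R a ->
  sorted ltn (incl c a).
Proof.
move=> ic sub ia; apply: nth_sorted_ltn => i j ij; rewrite size_map => hj.
have hi := ltn_trans ij hj.
rewrite !(nth_map 0) // ltnNge; apply/negP => le.
have ac : nth 0 a i \in c by apply: sub; rewrite mem_nth.
have bc : nth 0 a j \in c by apply: sub; rewrite mem_nth.
move: le; rewrite -(increasing_le ic) ?index_mem // !nth_index //.
by rewrite increasing_le // leqNgt ij.
Qed.

Lemma all_incl c a : {subset a <= c} -> all (gtn (size c)) (incl c a).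
Proof. by move=> sub; apply/allP => x /mapP[y /sub yc ->] /=; rewrite index_mem. Qed.

Lemma pat_exists a b : increasing R a -> increasing R b ->
  exists g h, [/\ sorted ltn g, sorted ltn h & pat R a b g h].
Proof.
move=> ia ib; have [c ic ec] := increasing_union ia ib.
have ac : {subset a <= c} by move=> x xa; rewrite ec mem_cat xa.
have bc : {subset b <= c} by move=> x xb; rewrite ec mem_cat xb orbT.
exists (incl c a), (incl c b).
by split; [exact: sorted_incl|exact: sorted_incl|exact: pat_incl].
Qed.

End Patterns.

Section Domination.
Variables (D : set nat) (hD : predilator D).

Lemma tm_elt R s a g : Dbar_elt D R s a -> size a = size g -> sorted ltn g ->
  tm D s g.
Proof. by move=> [_ ss us] e sg; rewrite /tm -e. Qed.

(** By [pat_emb], every union list [c] embeds into the numbers in such a way that the two inclusions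
    become [g] and [h]; [tle_emb] then moves the comparison along this embedding. *)
Lemma Dbar_tle R s a t b g h : linear_order R ->
  Dbar_elt D R s a -> Dbar_elt D R t b -> sorted ltn g -> sorted ltn h ->
  pat R a b g h ->
  (Dbar D R (npair s (code a)) (npair t (code b)) <-> tle D s g t h).
Proof.
move=> hR es et sg sh pt; have [sag sbh _] := pt.
have [ia _ _] := es; have [ib _ _] := et.
have ts := tm_elt es sag sg; have tt := tm_elt et sbh sh.
pose n := maxn (max_list g) (max_list h).
have gn : all (gtn n) g by apply: all_gtn_leq (all_max_list _); rewrite leq_maxl.
have hn : all (gtn n) h by apply: all_gtn_leq (all_max_list _); rewrite leq_maxr.
have key c : increasing R c -> c =i a ++ b ->
    (tle D s (incl c a) t (incl c b) <-> tle D s g t h) /\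
    [/\ tm D s (incl c a), tm D t (incl c b), all (gtn (size c)) (incl c a)
      & all (gtn (size c)) (incl c b)].
  move=> ic ec; have [f [ef fa fb]] := pat_emb hR ic ec ia ib sg sh pt gn hn.
  have ac : {subset a <= c} by move=> x xa; rewrite ec mem_cat xa.
  have bc : {subset b <= c} by move=> x xb; rewrite ec mem_cat xb orbT.
  have ts' : tm D s (incl c a).
    by apply: (tm_elt es); rewrite ?size_map //; apply: sorted_incl hR _ _ _ _ _.
  have tt' : tm D t (incl c b).
    by apply: (tm_elt et); rewrite ?size_map //; apply: sorted_incl hR _ _ _ _ _.
  split; last by split=> //; apply: all_incl.
  have := tle_emb hD ts' tt' (all_incl ac) (all_incl bc) ef.
  by rewrite fa fb.
split.
  move=> [s0 [a0 [t0 [b0 [e1 e2 _ _ [c [s' [t' [ic ec ms mt le]]]]]]]]].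
  case: (npair_inj e1) => es0 /code_inj ea; case: (npair_inj e2) => et0 /code_inj eb.
  subst s0 a0 t0 b0; have [<- [_ _ ac bc]] := key c ic ec.
  by exists (size c), s', t'.
move=> le; exists s, a, t, b; split=> //.
have [c ic ec] := increasing_union hR ia ib.
have [k [ts' tt' ac bc]] := key c ic ec.
move/k: le; have [s' ms] := tm_val hD ts' ac; have [t' mt] := tm_val hD tt' bc.
by move/(tle_at hD ts' tt' ac bc ms mt) => le; exists c, s', t'.
Qed.

Lemma Dbar_strict R s a t b g h : linear_order R ->
  Dbar_elt D R s a -> Dbar_elt D R t b -> sorted ltn g -> sorted ltn h ->
  pat R a b g h ->
  (strict (Dbar D R) (npair s (code a)) (npair t (code b)) <-> ~ tle D t h s g).
Proof.
move=> hR es et sg sh pt; have [sag sbh pp] := pt.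
have ts := tm_elt es sag sg; have tt := tm_elt et sbh sh.
rewrite /strict (Dbar_tle hR es et sg sh pt); split.
  move=> [le ne] le'; have [e1 e2] := tle_anti hD ts tt le le'.
  subst t h; apply: ne; congr (npair _ (code _)).
  have sab : size a = size b by rewrite sag sbh.
  apply: (@eq_from_nth _ 0) => // i hi.
  have hi' : i < size b by rewrite -sab.
  have [[_ p1] [_ p2]] := pp i i hi hi'.
  by have [_ anti _ _] := hR; apply: anti; [apply: p1|apply: p2].
move=> nle; split; first by have [] := tle_total hD ts tt.
move=> e; have [e1 /code_inj e2] := npair_inj e; subst t b.
apply: nle; have [ia _ _] := es.
suff <- : g = h by apply: tle_refl.
apply: (@eq_from_nth _ 0); rewrite -sag // => i hi.
have r := increasing_refl ia hi.
have [[p1 _] [p2 _]] := pp i i hi hi.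
by apply/eqP; rewrite eqn_leq; apply/andP; split; [apply: p1|apply: p2].
Qed.

Lemma increasing_sorted g : sorted ltn g -> increasing (fun x y => x <= y) g.
Proof.
move=> sg; split; first by apply: sorted_uniq sg; [exact: ltn_trans|exact: ltnn].
by move=> i j ij hj; rewrite sorted_ltn_leq //; apply: leq_ltn_trans hj.
Qed.

(** The terms are read as elements of [Dbar] over the natural numbers, and [Dbar_tle] is applied
    with both placements. *)
Lemma tle_pat s g h t g' h' : tm D s g -> tm D t h ->
  sorted ltn g' -> sorted ltn h' -> pat (fun x y => x <= y) g h g' h' ->
  (tle D s g t h <-> tle D s g' t h').
Proof.
move=> ts tt sg' sh' pt.
have [sg ss us] := ts; have [sh st ut] := tt.
have es : Dbar_elt D (fun x y => x <= y) s g by split=> //; apply: increasing_sorted.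
have et : Dbar_elt D (fun x y => x <= y) t h by split=> //; apply: increasing_sorted.
by rewrite -(Dbar_tle linear_leq es et sg' sh' pt) -(Dbar_tle linear_leq es et sg sh).
Qed.

Lemma tle_map m s g h t : tm D s g -> tm D t h ->
  {in g ++ h &, {homo m : x y / x < y}} ->
  (tle D s g t h <-> tle D s (map m g) t (map m h)).
Proof.
move=> ts tt mono.
have mle : {in g ++ h &, {mono m : x y / x <= y}}.
  by apply: leq_mono_in; move=> x y xi yi; apply: mono.
have [sg _ _] := ts; have [sh _ _] := tt.
apply: tle_pat => //.
- apply: (homo_sorted_in mono _ sg); apply/allP => x xg.
  by change (x \in g ++ h); rewrite mem_cat xg.
- apply: (homo_sorted_in mono _ sh); apply/allP => x xh.
  by change (x \in g ++ h); rewrite mem_cat xh orbT.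
split; rewrite ?size_map // => i j hi hj.
by rewrite !(nth_map 0) // !mle // mem_cat mem_nth // orbT.
Qed.

End Domination.

(** * Leading variables *)

Lemma exists_greatest (T : eqType) (le : T -> T -> Prop) (l : seq T) :
  {in l &, forall x y, le x y \/ le y x} ->
  {in l & &, forall x y z, le x y -> le y z -> le x z} -> l <> [::] ->
  exists2 p, p \in l & {in l, forall q, le q p}.
Proof.
elim: l => // x l ih tot tra _.
have refl : le x x by case: (tot x x); rewrite ?mem_head.
have [->|ne] := eqVneq l [::].
  by exists x; rewrite ?mem_head // => q; rewrite inE => /eqP->.
have [] := ih.
- by move=> y z yl zl; apply: tot; rewrite inE ?yl ?zl orbT.
- by move=> y z w yl zl wl; apply: tra; rewrite inE ?yl ?zl ?wl orbT.
- by apply/eqP.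
move=> p pl hp; have pxl : p \in x :: l by rewrite inE pl orbT.
have [xp|px] := tot x p (mem_head _ _) pxl.
  by exists p => // q; rewrite inE => /orP[/eqP->//|/hp].
exists x; first exact: mem_head.
move=> q; rewrite inE => /orP[/eqP->//|ql].
by apply: (tra q p x) => //; rewrite ?mem_head // ?inE ?ql ?orbT //; apply: hp.
Qed.

Section Dominating.
Variables (D : set nat) (hD : predilator D).

Definition full (s n : nat) : Prop :=
  D_le D n s s /\ D_supp D n s (iota 0 n).

Lemma tm_full s n g : full s n -> sorted ltn g -> size g = n -> tm D s g.
Proof. by move=> [h1 h2] sg e; rewrite /tm e. Qed.

(* Moving a variable from its low to its high value in [raise n p] while another
   one moves back is the typical change whose effect decides which of the two
   variables has precedence. *)
Definition raise n p : seq nat := mkseq (fun r => 4 * r + 1 + (r == p)) n.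

Lemma raise_sorted n p : sorted ltn (raise n p).
Proof.
apply: nth_sorted_ltn => i j ij; rewrite size_mkseq => hj.
by rewrite !nth_mkseq //; lia.
Qed.

(** The lists [g] and [h] lie relative to each other exactly as [raise n q] and [raise n p] do. *)
Lemma precedence s n p q g h : full s n -> p < n -> q < n -> p != q ->
  tle D s (raise n q) s (raise n p) ->
  sorted ltn g -> sorted ltn h -> size g = n -> size h = n ->
  (forall r, r < n -> r != p -> r != q -> nth 0 g r = nth 0 h r) ->
  nth 0 g p < nth 0 h p -> nth 0 h q < nth 0 g q -> tle D s g s h.
Proof.
move=> fs pn qn pq le sg sh ng nh eq ltp ltq.
have tr k : tm D s (raise n k).
  by apply: tm_full fs (raise_sorted _ _) _; rewrite size_mkseq.
apply: (proj1 (tle_pat hD (tr q) (tr p) sg sh _) le).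
split; rewrite ?size_mkseq ?ng ?nh // => i j hi hj.
rewrite !nth_mkseq //.
have lt_gh k l : k < l -> l < n -> nth 0 g k < nth 0 h l.
  move=> kl ln; have kn := ltn_trans kl ln.
  have [kq|kq] := eqVneq k q.
    have [lp|lp] := eqVneq l p.
      by subst k l; apply: ltn_trans _ ltp; apply: sorted_nth_lt => //; rewrite ng.
    have lq : l != q by apply/eqP => lq; move: kl; rewrite kq lq ltnn.
    by rewrite -(eq l ln lp lq); apply: sorted_nth_lt => //; rewrite ng.
  apply: (@leq_ltn_trans (nth 0 h k)); last by apply: sorted_nth_lt => //; rewrite nh.
  by have [->|kp] := eqVneq k p; [apply: ltnW|rewrite eq].
have lt_hg k l : k < l -> l < n -> nth 0 h k < nth 0 g l.
  move=> kl ln; have kn := ltn_trans kl ln.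
  have [kp|kp] := eqVneq k p.
    have [lq|lq] := eqVneq l q.
      by subst k l; apply: ltn_trans _ ltq; apply: sorted_nth_lt => //; rewrite nh.
    have lp : l != p by apply/eqP => lp; move: kl; rewrite kp lp ltnn.
    by rewrite (eq l ln lp lq); apply: sorted_nth_lt => //; rewrite nh.
  apply: (@leq_ltn_trans (nth 0 g k)); last by apply: sorted_nth_lt => //; rewrite ng.
  by have [->|kq] := eqVneq k q; [apply: ltnW|rewrite -eq].
case: (ltngtP i j) => ij.
- by have := lt_gh _ _ ij hj; split; split; lia.
- by have := lt_hg _ _ ij hi; split; split; lia.
subst j; have [ip|ip] := eqVneq i p.
  by subst i; rewrite (negbTE pq); split; split; lia.
have [iq|iq] := eqVneq i q; first by subst i; split; split; lia.
by rewrite (eq _ hi ip iq); split; split; lia.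
Qed.

(** The variables in [V] other than [p] may move arbitrarily. *)
Definition dominates s n (V : pred nat) p : Prop :=
  forall g h, sorted ltn g -> sorted ltn h -> size g = n -> size h = n ->
  (forall r, r < n -> ~~ V r -> nth 0 g r = nth 0 h r) ->
  nth 0 g p < nth 0 h p -> ~ tle D s h s g.

(** The passage from [g] to [h] is split into steps. Each step raises [p] slightly and lowers at
    most one other variable, so it does not lower the term by [precedence]; the remaining increases
    are covered by monotonicity. *)
Lemma dominates_of_precedence s n (V : pred nat) p : full s n -> p < n ->
  (forall q, q < n -> V q -> tle D s (raise n q) s (raise n p)) ->
  dominates s n V p.
Proof.
move=> fs pn prec g h sg sh ng nh eqV ltp.
(* After scaling by [N], there is room for [n] unit raises of [p] between consecutive multiples. In
   [step k] the positions below [k] other than [p] have been lowered to the minimum of [g] and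
   [h]. *)
pose N := n.+2.
pose step k := mkseq (fun r => if r == p then nth 0 g p * N + k else
  (if r < k then minn (nth 0 g r) (nth 0 h r) else nth 0 g r) * N) n.
have lg i j : i < j -> j < n -> nth 0 g i < nth 0 g j.
  by move=> ij jn; apply: sorted_nth_lt => //; rewrite ng.
have lh i j : i < j -> j < n -> nth 0 h i < nth 0 h j.
  by move=> ij jn; apply: sorted_nth_lt => //; rewrite nh.
have sstep k : k <= n -> sorted ltn (step k).
  move=> kn; apply: nth_sorted_ltn => i j ij; rewrite size_mkseq => hj.
  have hi := ltn_trans ij hj; rewrite !nth_mkseq //.
  have := lg _ _ ij hj; have := lh _ _ ij hj; rewrite /N.
  case: eqVneq => [ei|_]; case: eqVneq => [ej|_]; try subst i; try subst j.
  - by lia.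
  - by case: ifP => _; nia.
  - by case: ifP => _; nia.
  - by case: (ltnP i k) => hik; case: (ltnP j k) => hjk; nia.
have tstep k : k <= n -> tm D s (step k).
  by move=> kn; apply: tm_full fs (sstep _ kn) _; rewrite size_mkseq.
have le_step k : k < n -> tle D s (step k) s (step k.+1).
  move=> kn; have [tk tk1] := (tstep _ (ltnW kn), tstep _ kn).
  have sz a b : size (step a) = size (step b) by rewrite !size_mkseq.
  have [kp|kp] := eqVneq k p.
    apply: (tle_mono hD) => //; rewrite size_mkseq => i hi; rewrite !nth_mkseq //.
    by case: eqVneq => [|ip]; first lia; rewrite ltnS (leq_eqVlt i k) kp (negbTE ip).
  have [hg|hg] := leqP (nth 0 g k) (nth 0 h k).
    apply: (tle_mono hD) => //; rewrite size_mkseq => i hi; rewrite !nth_mkseq //.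
    case: eqVneq => [|ip]; first lia.
    rewrite ltnS (leq_eqVlt i k); case: eqVneq => [->|//].
    by rewrite ltnn /= (minn_idPl hg).
  have Vk : V k by apply: contraLR hg => nV; rewrite -leqNgt eqV.
  have pk : p != k by rewrite eq_sym.
  apply: (precedence fs pn kn pk (prec _ kn Vk)); rewrite ?size_mkseq //.
  - exact/sstep/ltnW.
  - exact: sstep.
  - move=> r rn rp rk; rewrite !nth_mkseq // (negbTE rp).
    by rewrite ltnS (leq_eqVlt r k) (negbTE rk).
  - by rewrite !nth_mkseq // eqxx; lia.
  - rewrite !nth_mkseq // (negbTE kp) ltnSn ltnn /N; nia.
have lek k : k <= n -> tle D s (step 0) s (step k).
  elim: k => [|k ih] kn; first exact: tle_refl (tstep _ _).
  by apply: (tle_trans hD (tstep 0 isT) (tstep k (ltnW kn)) (tstep _ kn));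
    [apply: ih (ltnW kn)|apply: le_step].
have tg := tm_full fs sg ng; have th := tm_full fs sh nh.
have mN : {in h ++ g &, {homo (fun x => x * N) : x y / x < y}}.
  by move=> x y _ _; rewrite /N; nia.
move/(tle_map hD th tg mN) => le.
have sm a : sorted ltn a -> sorted ltn (map (fun x => x * N) a).
  by rewrite sorted_map; apply: sub_sorted => x y /=; rewrite /N; nia.
have tg' : tm D s (map (fun x => x * N) g) by apply: tm_full fs (sm _ sg) _; rewrite size_map.
have th' : tm D s (map (fun x => x * N) h) by apply: tm_full fs (sm _ sh) _; rewrite size_map.
have le2 : tle D s (step n) s (map (fun x => x * N) h).
  apply: (tle_mono hD (tstep n (leqnn n)) th'); rewrite ?size_mkseq ?size_map // => i hi.
  rewrite nth_mkseq // (nth_map 0) ?nh // /N.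
  case: eqVneq => [->|_]; first nia.
  by rewrite hi; nia.
have e0 : step 0 = map (fun x => x * N) g.
  apply: (@eq_from_nth _ 0); rewrite size_mkseq ?size_map // => i hi.
  by rewrite nth_mkseq // (nth_map 0) ?ng //; case: eqVneq => [->|]; rewrite ?addn0.
have le3 := tle_trans hD (tstep 0 isT) (tstep n (leqnn n)) th' (lek _ (leqnn n)) le2.
rewrite e0 in le3.
have [_ e] := tle_anti hD th' tg' le le3.
have := congr1 (fun l => nth 0 l p) e; rewrite !(nth_map 0) ?ng ?nh // /N; nia.
Qed.

(** Comparing the terms [raise n q] yields a total preorder on positions; a greatest position within
    [V] dominates. *)
Lemma dominating_exists s n (V : pred nat) : full s n ->
  (exists2 r, r < n & V r) -> exists p, [/\ p < n, V p & dominates s n V p].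
Proof.
move=> fs [r rn Vr].
have tr k : tm D s (raise n k).
  by apply: tm_full fs (raise_sorted _ _) _; rewrite size_mkseq.
have [||/=|p] := @exists_greatest _ (fun q p => tle D s (raise n q) s (raise n p))
  [seq r <- iota 0 n | V r].
- by move=> x y _ _; apply: tle_total.
- by move=> x y z _ _ _; apply: (tle_trans hD).
- move=> e; have : r \in [seq r <- iota 0 n | V r] by rewrite mem_filter Vr mem_iota.
  by rewrite e.
rewrite mem_filter mem_iota => /andP[Vp /andP[_ pn]] hp; exists p; split=> //.
apply: dominates_of_precedence => // q qn Vq; apply: hp.
by rewrite mem_filter Vq mem_iota.
Qed.

End Dominating.

(** * Frozen variables and gluing of placements *)

Definition cell (F : seq nat) (x : nat) : nat := count (fun f => f <= x) F.

Lemma cell_leq F x y : x <= y -> cell F x <= cell F y.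
Proof. by move=> xy; apply: sub_count => f /= fx; apply: leq_trans xy. Qed.

Lemma cell_ltn F x y : y \in F -> x < y -> cell F x < cell F y.
Proof.
move=> yF xy; elim: F yF => //= f F ih; rewrite inE => /orP[/eqP<-|/ih h].
  by have := cell_leq F (ltnW xy); rewrite /cell; lia.
by move: h; rewrite /cell; lia.
Qed.

Lemma cell_ltn_inv F x y : cell F x < cell F y -> x < y.
Proof. by case: (leqP y x) => // yx; have := cell_leq F yx; lia. Qed.

Lemma cell_map g F p : sorted ltn g -> all (gtn (size g)) F -> p < size g ->
  cell (map (nth 0 g) F) (nth 0 g p) = cell F p.
Proof.
move=> sg /allP hF hp; rewrite /cell count_map; apply: eq_in_count => f /hF /= fg.
by rewrite sorted_ltn_leq.
Qed.

Lemma cell_iota F x :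
  cell F x = count (fun j => nth 0 F j <= x) (iota 0 (size F)).
Proof. by rewrite /cell -[in LHS](mkseq_nth 0 F) /mkseq count_map. Qed.

(* Two worlds [A] and [B] of natural numbers are glued along [FA] and [FB]; in
   each gap, all of [B] is put between the numbers of [A] below [th] and those
   from [th] on. *)
Lemma amalgam (FA FB : seq nat) (th N : nat) : size FA = size FB ->
  (forall i j, i < size FA -> j < size FA ->
    (nth 0 FA i <= nth 0 FA j) = (nth 0 FB i <= nth 0 FB j)) ->
  exists mA mB : nat -> nat, [/\
    forall x y, x < y -> y < N -> mA x < mA y,
    forall x y, x < y -> y < N -> mB x < mB y,
    map mA FA = map mB FB,
    forall x y, x < N -> y < N -> x \notin FA -> y \notin FB ->
      cell FA x = cell FB y -> x < th -> mA x < mB y &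
    forall x y, x < N -> y < N -> x \notin FA -> y \notin FB ->
      cell FA x = cell FB y -> th <= x -> mB y < mA x].
Proof.
move=> sz ord.
(* Every gap receives four blocks of length [N]: a frozen value starts block 0, block 1 holds the
   lower part of [A], block 2 all of [B], and block 3 the upper part of [A]. *)
pose m F (part : nat -> nat) x :=
  if x \in F then cell F x * 4 * N else (cell F x * 4 + part x) * N + x.
have mono F part : (forall x, 0 < part x < 4) ->
    (forall x y, x <= y -> part x <= part y) ->
    forall x y, x < y -> y < N -> m F part x < m F part y.
  move=> bd mon x y xy yN; have cxy := cell_leq F (ltnW xy).
  have := mon _ _ (ltnW xy); have := bd x; have := bd y; rewrite /m.
  case: ifP => xF; case: ifP => yF.
  - by have := cell_ltn yF xy; nia.
  - by nia.
  - by have := cell_ltn yF xy; nia.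
  - by nia.
exists (m FA (fun x => if x < th then 1 else 3)), (m FB (fun=> 2)); split.
- apply: mono => [x|x y xy]; first by case: ifP.
  by case: (ltnP y th) => yt; case: (ltnP x th) => //; lia.
- exact: mono.
- apply: (@eq_from_nth _ 0); rewrite ?size_map // => i hi.
  have hi' : i < size FB by rewrite -sz.
  rewrite !(nth_map 0) // /m !mem_nth //; congr (_ * _ * _).
  rewrite !cell_iota -sz.
  by apply: eq_in_count => j; rewrite mem_iota => /andP[_ hj] /=; rewrite ord.
- by move=> x y xN yN xF yF e xt; rewrite /m (negbTE xF) (negbTE yF) e xt; nia.
- move=> x y xN yN xF yF e xt; rewrite /m (negbTE xF) (negbTE yF) e (leq_gtF xt).
  by nia.
Qed.

(* A term of arity [ft_n], in which the variables at the positions [ft_F] are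
   regarded as frozen. *)
Record fterm := FTerm { ft_s : nat; ft_n : nat; ft_F : seq nat }.

Section Frozen.
Variables (D : set nat) (hD : predilator D).
Implicit Types X Y Z : fterm.

Definition okf X : Prop := full D (ft_s X) (ft_n X) /\ all (gtn (ft_n X)) (ft_F X).

Definition placed X g : Prop := sorted ltn g /\ size g = ft_n X.

Definition vals X g := map (nth 0 g) (ft_F X).

Definition flt X g Y h : Prop := ~ tle D (ft_s Y) h (ft_s X) g.

Definition below X Y : Prop := forall g h, placed X g -> placed Y h ->
  vals X g = vals Y h -> flt X g Y h.

(** The value [None] covers the case that all variables are frozen, when there is no leading
    variable. *)
Definition fdom X (op : option nat) : Prop :=
  if op is Some p then
    [/\ p < ft_n X, p \notin ft_F X &
        dominates D (ft_s X) (ft_n X) (fun r => r \notin ft_F X) p]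
  else forall r, r < ft_n X -> r \in ft_F X.

Lemma fdom_exists X : okf X -> exists op, fdom X op.
Proof.
move=> [fX _]; case: (pselect (exists2 r, r < ft_n X & r \notin ft_F X)) => h.
  by have [p [pn pV dp]] := dominating_exists hD (V := fun r => r \notin ft_F X) fX h;
    exists (Some p).
exists None => r rn; apply/negPn/negP => rF; apply: h; by exists r.
Qed.

Lemma tm_placed X g : okf X -> placed X g -> tm D (ft_s X) g.
Proof. by move=> [fX _] [sg ng]; apply: tm_full fX sg ng. Qed.

Lemma placed_map X g m N : placed X g -> all (gtn N) g ->
  (forall x y, x < y -> y < N -> m x < m y) -> placed X (map m g).
Proof.
move=> [sg ng] /allP gN mono; split; rewrite ?size_map //.
apply: nth_sorted_ltn => i j ij; rewrite size_map => hj.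
rewrite !(nth_map 0) ?(ltn_trans ij) //; apply: mono; first exact: sorted_nth_lt.
by apply: gN; rewrite mem_nth.
Qed.

Lemma vals_map X g m : okf X -> placed X g -> vals X (map m g) = map m (vals X g).
Proof.
move=> [_ /allP hF] [_ ng]; rewrite /vals -map_comp; apply/eq_in_map => f /hF /= fn.
by rewrite (nth_map 0) // ng.
Qed.

Lemma tle_map_ltn m N s g t h : tm D s g -> tm D t h ->
  all (gtn N) g -> all (gtn N) h ->
  (forall x y, x < y -> y < N -> m x < m y) ->
  (tle D s g t h <-> tle D s (map m g) t (map m h)).
Proof.
move=> ts tt /allP gN /allP hN mono; apply: tle_map => // x y _ + xy.
by rewrite mem_cat => /orP[/gN|/hN] /= yN; apply: mono.
Qed.

Lemma vals_notin X g r : okf X -> placed X g -> r < ft_n X -> r \notin ft_F X ->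
  nth 0 g r \notin vals X g.
Proof.
move=> [_ /allP hF] [sg ng] rn rF; apply/negP => /mapP[f fF /eqP].
rewrite nth_uniq ?ng //; last by apply: sorted_uniq sg; [exact: ltn_trans|exact: ltnn].
  by move/eqP => e; move: rF; rewrite e fF.
exact: hF fF.
Qed.

Lemma fdom_le X op g h : okf X -> fdom X op -> placed X g -> placed X h ->
  vals X g = vals X h -> (if op is Some p then nth 0 g p < nth 0 h p else true) ->
  tle D (ft_s X) g (ft_s X) h /\ (op <> None -> flt X g X h).
Proof.
move=> oX dX pg ph e; have [tg th] := (tm_placed oX pg, tm_placed oX ph).
have [sg ng] := pg; have [sh nh] := ph.
have eqF r : r \in ft_F X -> nth 0 g r = nth 0 h r.
  by move=> rF; move: r rF; apply/eq_in_map.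
case: op dX => [p [pn pF dp] lt|all_F _].
  have nle : flt X g X h.
    by apply: dp => // r rn; rewrite negbK => /eqF.
  by split=> //; have [] := tle_total hD tg th.
split=> //; suff -> : g = h by apply: tle_refl.
by apply: (@eq_from_nth _ 0); rewrite ng // => r rn; apply/eqF/all_F.
Qed.

(* If [X] is once above [Y] although its leading variable is below that of [Y],
   then it is always above [Y]: by gluing, the leading variable of [X] can be
   raised and that of [Y] lowered to reach any given placement. *)
Lemma two_terms X Y op oq g0 h0 g1 h1 : okf X -> okf Y ->
  (forall i j, i < size (ft_F X) -> j < size (ft_F X) ->
    (nth 0 (ft_F X) i <= nth 0 (ft_F X) j) = (nth 0 (ft_F Y) i <= nth 0 (ft_F Y) j)) ->
  fdom X op -> fdom Y oq -> placed X g0 -> placed Y h0 ->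
  placed X g1 -> placed Y h1 -> vals X g0 = vals Y h0 -> vals X g1 = vals Y h1 ->
  (if (op, oq) is (Some p, Some q) then nth 0 g0 p < nth 0 h0 q else true) ->
  tle D (ft_s Y) h0 (ft_s X) g0 -> tle D (ft_s X) g1 (ft_s Y) h1 ->
  [/\ op = None, oq = None & tle D (ft_s Y) h1 (ft_s X) g1].
Proof.
move=> oX oY ordXY dX dY pg0 ph0 pg1 ph1 e0 e1 cond le0 le1.
pose N := foldr maxn 0 (map max_list [:: g0; h0; g1; h1]).
have bg0 : all (gtn N) g0 by apply: all_gtn_leq (all_max_list _); rewrite /N /=; lia.
have bh0 : all (gtn N) h0 by apply: all_gtn_leq (all_max_list _); rewrite /N /=; lia.
have bg1 : all (gtn N) g1 by apply: all_gtn_leq (all_max_list _); rewrite /N /=; lia.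
have bh1 : all (gtn N) h1 by apply: all_gtn_leq (all_max_list _); rewrite /N /=; lia.
(* The threshold separates the leading variables: that of [X] in [g0] lies below it, that of [Y] in
   [h0] does not. Hence passing to the second world raises [X] and lowers [Y]. *)
pose th := if oq is Some q then nth 0 h0 q
  else if op is Some p then (nth 0 g0 p).+1 else 0.
have szX g : size (vals X g) = size (ft_F X) by rewrite size_map.
have ordX g : placed X g -> forall i j, i < size (ft_F X) -> j < size (ft_F X) ->
    (nth 0 (vals X g) i <= nth 0 (vals X g) j) = (nth 0 (ft_F X) i <= nth 0 (ft_F X) j).
  move=> [sg ng] i j hi hj; have [_ /allP hF] := oX.
  by rewrite !(nth_map 0) // sorted_ltn_leq // ng; apply: hF; rewrite mem_nth.
have [||mA [mB [monA monB glue lo hi]]] := @amalgam (vals X g0) (vals X g1) th N.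
- by rewrite !szX.
- by move=> i j; rewrite szX => hi hj; rewrite !ordX.
have cellE Z (g : seq nat) p : okf Z -> placed Z g -> p < ft_n Z ->
    cell (vals Z g) (nth 0 g p) = cell (ft_F Z) p.
  by move=> [_ hF] [sg ng] pn; apply: cell_map; rewrite ?ng.
have bnd (Z : fterm) (g : seq nat) p : placed Z g -> all (gtn N) g -> p < ft_n Z -> nth 0 g p < N.
  by move=> [_ ng] /allP hg pn; apply: hg; rewrite mem_nth // ng.
have pA0 := placed_map pg0 bg0 monA; have qA0 := placed_map ph0 bh0 monA.
have pB1 := placed_map pg1 bg1 monB; have qB1 := placed_map ph1 bh1 monB.
have tA := tm_placed oX pA0; have tB := tm_placed oX pB1.
have uA := tm_placed oY qA0; have uB := tm_placed oY qB1.
have [leX ltX] : tle D (ft_s X) (map mA g0) (ft_s X) (map mB g1) /\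
    (op <> None -> flt X (map mA g0) X (map mB g1)).
  apply: (fdom_le oX dX pA0 pB1); first by rewrite !vals_map.
  case: op dX cond @th lo {hi} => // p [pn pF _] cond th lo.
  have [_ ng0] := pg0; have [_ ng1] := pg1.
  rewrite !(nth_map 0) ?ng0 ?ng1 //; apply: lo.
  - exact: bnd pg0 bg0 pn.
  - exact: bnd pg1 bg1 pn.
  - exact: vals_notin.
  - exact: vals_notin.
  - by rewrite !cellE.
  - by rewrite /th; case: oq {dY th} cond.
have [leY ltY] : tle D (ft_s Y) (map mB h1) (ft_s Y) (map mA h0) /\
    (oq <> None -> flt Y (map mB h1) Y (map mA h0)).
  apply: (fdom_le oY dY qB1 qA0); first by rewrite !vals_map // -e0 -e1.
  case: oq dY cond @th lo hi => // q [qn qF _] cond th _ hi.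
  have [_ nh0] := ph0; have [_ nh1] := ph1.
  rewrite !(nth_map 0) ?nh0 ?nh1 //; apply: hi; rewrite ?e0 ?e1.
  - exact: bnd ph0 bh0 qn.
  - exact: bnd ph1 bh1 qn.
  - exact: vals_notin.
  - exact: vals_notin.
  - by rewrite !cellE.
  - by rewrite /th.
move: (le0) (le1); rewrite (tle_map_ltn (tm_placed oY ph0) (tm_placed oX pg0) bh0 bg0 monA).
rewrite (tle_map_ltn (tm_placed oX pg1) (tm_placed oY ph1) bg1 bh1 monB) => le0' le1'.
(* The placed terms form a cycle from [g0] via [g1], [h1] and [h0] back to [g0]. So no step is
   strict, which rules out leading variables. *)
have back : tle D (ft_s X) (map mB g1) (ft_s X) (map mA g0).
  apply: (tle_trans hD tB uA tA) le0'; exact: (tle_trans hD tB uB uA).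
have back' : tle D (ft_s Y) (map mA h0) (ft_s Y) (map mB h1).
  apply: (tle_trans hD uA tB uB) le1'; exact: (tle_trans hD uA tA tB).
have nX : op = None by apply: contrapT => /ltX; apply.
have nY : oq = None by apply: contrapT => /ltY; apply.
split=> //.
rewrite (tle_map_ltn (tm_placed oY ph1) (tm_placed oX pg1) bh1 bg1 monB).
apply: (tle_trans hD uB uA tB) => //; exact: (tle_trans hD uA tA tB).
Qed.

End Frozen.

Section Comparable.
Variables (D : set nat) (hD : predilator D).
Implicit Types X Y Z : fterm.

Definition fcompat X Y : Prop := size (ft_F X) = size (ft_F Y) /\
  forall i j, i < size (ft_F X) -> j < size (ft_F X) ->
    (nth 0 (ft_F X) i <= nth 0 (ft_F X) j) = (nth 0 (ft_F Y) i <= nth 0 (ft_F Y) j).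

Lemma fcompat_sym X Y : fcompat X Y -> fcompat Y X.
Proof. by move=> [e h]; split=> // i j; rewrite -e => hi hj; rewrite h. Qed.

Definition compared_at X p Y q : Prop := forall g h,
  placed X g -> placed Y h -> vals X g = vals Y h ->
  (nth 0 g p < nth 0 h q -> flt D X g Y h) /\
  (nth 0 h q < nth 0 g p -> flt D Y h X g).

Lemma cell_vals X g p : okf D X -> placed X g -> p < ft_n X ->
  cell (vals X g) (nth 0 g p) = cell (ft_F X) p.
Proof. by move=> [_ hF] [sg ng] pn; apply: cell_map; rewrite ?ng. Qed.

(** Both orders of [X] and [Y] occur: one in [g1], [h1], the other since [below] fails. By
    [two_terms], the leading variables must then exist and decide the comparison. *)
Lemma comparable_terms X Y op oq g1 h1 : okf D X -> okf D Y -> fcompat X Y ->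
  fdom D X op -> fdom D Y oq -> ~ below D X Y ->
  placed X g1 -> placed Y h1 -> vals X g1 = vals Y h1 -> flt D X g1 Y h1 ->
  exists p q, [/\ op = Some p, oq = Some q, cell (ft_F X) p = cell (ft_F Y) q &
    compared_at X p Y q].
Proof.
move=> oX oY cXY dX dY nb pg1 ph1 e1 lt1.
have le1 := tlt_le hD (tm_placed oX pg1) (tm_placed oY ph1) lt1.
have [g0 [h0 [pg0 ph0 e0 le0]]] : exists g h,
    [/\ placed X g, placed Y h, vals X g = vals Y h & tle D (ft_s Y) h (ft_s X) g].
  apply: contrapT => no; apply: nb => g h pg ph e le; apply: no; by exists g, h.
have notXY g h : placed X g -> placed Y h -> vals X g = vals Y h ->
    (if (op, oq) is (Some p, Some q) then nth 0 g p < nth 0 h q else true) ->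
    flt D X g Y h.
  move=> pg ph e cond le.
  have [_ _ le2] := two_terms hD oX oY (proj2 cXY) dX dY pg ph pg1 ph1 e e1 cond le le1.
  exact: lt1 le2.
have [p ep] : exists p, op = Some p.
  by case: op {dX} notXY => [p _|notXY]; [exists p|case: (notXY g0 h0)].
have [q eq] : exists q, oq = Some q.
  case: oq {dY} notXY => [q _|notXY]; [by exists q|].
  by case: (notXY g0 h0) => //; rewrite ep.
subst op oq; exists p, q.
have at_pq : compared_at X p Y q.
  move=> g h pg ph e; split; first exact: notXY.
  move=> lt le; apply: nb => g2 h2 pg2 ph2 e2 le2.
  by have [] := two_terms hD oY oX (proj2 (fcompat_sym cXY)) dY dX ph pg ph2 pg2
    (esym e) (esym e2) lt le le2.
split=> //; have [pn _ _] := dX; have [qn _ _] := dY.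
(* In different gaps, the leading variables would always be in the same order, and only one order of
   the terms could occur. *)
apply/eqP; rewrite eqn_leq; apply/andP; split; rewrite leqNgt; apply/negP => lt.
  have [_ gt] := at_pq _ _ pg1 ph1 e1; apply: (gt _ le1).
  by apply: (@cell_ltn_inv (vals Y h1)); rewrite cell_vals // -e1 cell_vals.
have [lt0 _] := at_pq _ _ pg0 ph0 e0; apply: (lt0 _ le0).
by apply: (@cell_ltn_inv (vals X g0)); rewrite cell_vals // e0 cell_vals.
Qed.

(** A placement of [Z] is glued in with threshold [nth 0 h q], so that its variable [r] falls
    strictly between [p] and [q]; this is possible because all three lie in one gap. *)
Lemma compared_trans X p Y q Z r : okf D X -> okf D Y -> okf D Z ->
  fcompat X Z -> p < ft_n X -> q < ft_n Y -> r < ft_n Z ->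
  p \notin ft_F X -> q \notin ft_F Y -> r \notin ft_F Z ->
  cell (ft_F X) p = cell (ft_F Z) r -> cell (ft_F Y) q = cell (ft_F Z) r ->
  compared_at X p Z r -> compared_at Y q Z r ->
  forall g h, placed X g -> placed Y h -> vals X g = vals Y h ->
    nth 0 g p < nth 0 h q -> flt D X g Y h.
Proof.
move=> oX oY oZ cXZ pn qn rn pF qF rF cp cq atX atY g h pg ph e lt.
pose k := iota 0 (ft_n Z).
have pk : placed Z k by rewrite /placed size_iota iota_ltn_sorted.
pose N := foldr maxn 0 (map max_list [:: g; h; k]).
have bg : all (gtn N) g by apply: all_gtn_leq (all_max_list _); rewrite /N /=; lia.
have bh : all (gtn N) h by apply: all_gtn_leq (all_max_list _); rewrite /N /=; lia.
have bk : all (gtn N) k by apply: all_gtn_leq (all_max_list _); rewrite /N /=; lia.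
have bnd (W : fterm) (f : seq nat) x : placed W f -> all (gtn N) f -> x < ft_n W -> nth 0 f x < N.
  by move=> [_ nf] /allP hf xn; apply: hf; rewrite mem_nth // nf.
have [||mA [mB [monA monB glue lo hi]]] := @amalgam (vals X g) (vals Z k) (nth 0 h q) N.
- by rewrite !size_map; have [] := cXZ.
- move=> i j; rewrite size_map => hi hj; have [ez oz] := cXZ.
  have [sg ng] := pg; have [sk nk] := pk.
  have [_ /allP hX] := oX; have [_ /allP hZ] := oZ.
  have bX a : a < size (ft_F X) -> nth 0 (ft_F X) a < size g.
    by move=> ha; rewrite ng; apply: hX; rewrite mem_nth.
  have bZ a : a < size (ft_F X) -> nth 0 (ft_F Z) a < size k.
    by move=> ha; rewrite nk; apply: hZ; rewrite mem_nth // -ez.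
  rewrite !(nth_map 0) -?ez //.
  by rewrite (sorted_ltn_leq sg) ?(sorted_ltn_leq sk) ?oz //; auto.
have pA := placed_map pg bg monA; have hA := placed_map ph bh monA.
have kB := placed_map pk bk monB.
have l1 : flt D X (map mA g) Z (map mB k).
  have ev : vals X (map mA g) = vals Z (map mB k).
    by rewrite (vals_map _ oX) // (vals_map _ oZ).
  have [+ _] := atX _ _ pA kB ev; apply; have [_ ng] := pg; have [_ nk] := pk.
  rewrite !(nth_map 0) ?ng ?nk //; apply: lo => //.
  - exact: bnd pg bg pn.
  - exact: bnd pk bk rn.
  - exact: vals_notin oX pg pn pF.
  - exact: vals_notin oZ pk rn rF.
  - by rewrite !cell_vals.
have l2 : flt D Z (map mB k) Y (map mA h).
  have ev : vals Y (map mA h) = vals Z (map mB k).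
    by rewrite (vals_map _ oY) // (vals_map _ oZ) // -e.
  have [_] := atY _ _ hA kB ev; apply; have [_ nh] := ph; have [_ nk] := pk.
  rewrite !(nth_map 0) ?nh ?nk //; apply: hi; rewrite ?e //.
  - exact: bnd ph bh qn.
  - exact: bnd pk bk rn.
  - exact: vals_notin oY ph qn qF.
  - by rewrite -?e; exact: vals_notin oZ pk rn rF.
  - by rewrite !cell_vals.
have [tg th] := (tm_placed oX pA, tm_placed oY hA); have tk := tm_placed oZ kB.
rewrite /flt (tle_map_ltn hD (tm_placed oY ph) (tm_placed oX pg) bh bg monA) => le.
by apply: l1; apply: (tle_trans hD tk th tg) le; apply: tlt_le l2.
Qed.

End Comparable.

(** * Computations in omega-models *)

Local Open Scope classical_set_scope.
Local Open Scope nat_scope.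

Definition tpair t1 t2 := TAdd (TMul (TAdd t1 t2) (TAdd t1 t2)) t1.

Lemma teval_tpair e t1 t2 : teval e (tpair t1 t2) = npair (teval e t1) (teval e t2).
Proof. by rewrite /= /npair mulnn. Qed.

Fixpoint tnum k := if k is k'.+1 then TAdd TOne (tnum k') else TZero.

Lemma teval_tnum e k : teval e (tnum k) = k.
Proof. by elim: k => //= k ->. Qed.

Definition agree (b : nat) (A A' : set nat) : Prop := forall n, n < b -> (A' n <-> A n).

Lemma agree_leq b c A A' : b <= c -> agree c A A' -> agree b A A'.
Proof. by move=> bc h n nb; apply: h; apply: leq_trans bc. Qed.

Section UsePrinciple.
Variables (I : countType) (G : I -> set nat -> set nat -> set nat).

Definition matches (s : seq bool) (A : set nat) : Prop :=
  forall j, j < size s -> (A j <-> nth false s j).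

(** Pairing with [b] makes the code bound the lengths of the segments, so that quantifiers bounded
    by [w] reach all their positions. *)
Definition info (w : nat) (sa sb : seq bool) : Prop :=
  exists b, [/\ w = npair b (pickle (sa, sb)), size sa <= b & size sb <= b].

Definition forces w (P : set nat -> set nat -> Prop) : Prop := exists sa sb,
  info w sa sb /\ forall A B, matches sa A -> matches sb B -> P A B.

(** Tags 0 and 1 list the pairs of segments that force membership or non-membership. The other tags
    decode the bits of the segments. *)
Definition use_table (tag x y : nat) : Prop :=
  match tag with
  | 0 => exists i z, x = npair (pickle i) z /\ forces y (fun A B => G i A B z)
  | 1 => exists i z, x = npair (pickle i) z /\ forces y (fun A B => ~ G i A B z)
  | 2 => exists sa sb, [/\ info x sa sb, y < size sa & nth false sa y]
  | 3 => exists sa sb, [/\ info x sa sb, y < size sa & ~~ nth false sa y]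
  | 4 => exists sa sb, [/\ info x sa sb, y < size sb & nth false sb y]
  | _ => exists sa sb, [/\ info x sa sb, y < size sb & ~~ nth false sb y]
  end.

Definition use_oracle : set nat := fun n => exists t x y,
  n = npair t (npair x y) /\ use_table t x y.

Lemma use_oracleE t x y : use_oracle (npair t (npair x y)) <-> use_table t x y.
Proof.
split; last by move=> h; exists t, x, y.
by move=> [t' [x' [y' [/npair_inj[-> /npair_inj[-> ->]] h]]]].
Qed.

Lemma info_inj w sa sb sa' sb' : info w sa sb -> info w sa' sb' ->
  sa = sa' /\ sb = sb'.
Proof.
move=> [b [-> _ _]] [b' [/npair_inj[_ /(pcan_inj (@pickleK _))[-> ->]] _ _]].
by [].
Qed.

Lemma info_size w sa sb : info w sa sb -> size sa <= w /\ size sb <= w.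
Proof. by move=> [b [-> ha hb]]; rewrite /npair; nia. Qed.

Definition FYtab t x y := FIn (tpair (tnum t) (tpair x y)) 0.

Definition FMatch (t v : nat) : formula :=
  FAnd (FImp (FYtab t (TVar 1) (TVar 0)) (FIn (TVar 0) v))
       (FImp (FYtab t.+1 (TVar 1) (TVar 0)) (FNot (FIn (TVar 0) v))).

(** Set variables 0, 1 and 2 stand for the oracle, [A] and [B]; number variable 0 is the code of the
    segments. *)
Definition FCompat : formula := FAllB (TVar 0) (FAnd (FMatch 2 1) (FMatch 4 2)).

Lemma sat_FYtab e (E : nat -> set nat) t x y : E 0 = use_oracle ->
  sat e E (FYtab t x y) <-> use_table t (teval e x) (teval e y).
Proof.
move=> E0; rewrite -use_oracleE -E0 /FYtab.
by rewrite -[X in E 0 (npair X _)](teval_tnum e) -!teval_tpair.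
Qed.

Lemma sat_FMatch e (E : nat -> set nat) t v : E 0 = use_oracle ->
  sat e E (FMatch t v) <-> (use_table t (e 1) (e 0) -> E v (e 0)) /\
                           (use_table t.+1 (e 1) (e 0) -> ~ E v (e 0)).
Proof.
move=> E0; have h k := @sat_FYtab e E k (TVar 1) (TVar 0) E0.
by split=> -[h1 h2]; split=> /h; [exact: h1|exact: h2|exact: h1|exact: h2].
Qed.

Lemma sat_compat e (E : nat -> set nat) sa sb : E 0 = use_oracle ->
  info (e 0) sa sb -> sat e E FCompat <-> matches sa (E 1) /\ matches sb (E 2).
Proof.
move=> E0 iw; have [wa wb] := info_size iw; split.
  move=> h; split=> j hj.
    have [/(sat_FMatch _ _ _ E0)[h1 h2] _] := h j (leq_trans hj wa).
    split=> [Aj|nj]; last by apply: h1; exists sa, sb.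
    by apply/negPn/negP => nj; apply: h2 => //; exists sa, sb.
  have [_ /(sat_FMatch _ _ _ E0)[h1 h2]] := h j (leq_trans hj wb).
  split=> [Aj|nj]; last by apply: h1; exists sa, sb.
  by apply/negPn/negP => nj; apply: h2 => //; exists sa, sb.
move=> [ma mb] j _; split; apply/(sat_FMatch _ _ _ E0); split=> -[sa' [sb' [/(info_inj iw)[e1 e2]]]];
  subst sa' sb' => hj nj.
- exact/ma.
- by move/(ma _ hj); apply/negP.
- exact/mb.
- by move/(mb _ hj); apply/negP.
Qed.

(* The table of finite uses makes both the membership in [G i A B] and its
   negation Sigma01, so that Delta01-comprehension applies. *)
Lemma use_oracleP M : RCA0 M -> M use_oracle -> forall i A B, M A -> M B ->
  (forall z, exists b, forall A' B', agree b A A' -> agree b B B' ->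
    (G i A' B' z <-> G i A B z)) ->
  M (G i A B).
Proof.
move=> [_ [_ comp]] MY i A B MA MB use.
pose E k : set nat := if k is k'.+1 then (if k' is 0 then A else B) else use_oracle.
pose tab t := FAnd (FYtab t (tpair (TVar 2) (TVar 1)) (TVar 0)) FCompat.
have ME k : M (E k) by case: k => [|[|k]].
pose e := env_cons (pickle i) (fun=> 0).
have satS t z w : sat (env_cons w (env_cons z e)) E (tab t) <->
    use_table t (npair (pickle i) z) w /\ sat (env_cons w (env_cons z e)) E FCompat.
  have h := @sat_FYtab (env_cons w (env_cons z e)) E t
    (tpair (TVar 2) (TVar 1)) (TVar 0) erefl.
  by rewrite teval_tpair in h; split=> -[h1 h2]; split=> //; apply/h.
have tabP (P : set nat -> set nat -> Prop) z w sa sb : info w sa sb ->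
    (forall A B, matches sa A -> matches sb B -> P A B) ->
    sat (env_cons w (env_cons z e)) E FCompat -> P A B.
  by move=> iw h /(sat_compat (e := env_cons w _) erefl iw) [ma mb]; apply: h.
have sat0 z w : sat (env_cons w (env_cons z e)) E (tab 0) -> G i A B z.
  move/satS => [[i' [z' [/npair_inj[/(pcan_inj (@pickleK _)) <- <-]]]]].
  move=> [sa [sb [iw h]]]; exact: tabP iw h.
have sat1 z w : sat (env_cons w (env_cons z e)) E (tab 1) -> ~ G i A B z.
  move/satS => [[i' [z' [/npair_inj[/(pcan_inj (@pickleK _)) <- <-]]]]].
  move=> [sa [sb [iw h]]]; exact: tabP iw h.
(* The initial segments of [A] and [B] up to the finite use already decide whether [z] belongs to
   the set. *)
have ex_info z : exists w sa sb, [/\ info w sa sb,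
    sat (env_cons w (env_cons z e)) E FCompat &
    forall A' B', matches sa A' -> matches sb B' -> (G i A' B' z <-> G i A B z)].
  have [b hb] := use z.
  pose s (C : set nat) := mkseq (fun j => `[<C j>]) b.
  have sE C j : j < b -> (nth false (s C) j <-> C j).
    by move=> jb; rewrite nth_mkseq //; split=> /asboolP.
  have iw : info (npair b (pickle (s A, s B))) (s A) (s B).
    by exists b; rewrite !size_mkseq.
  exists (npair b (pickle (s A, s B))), (s A), (s B); split=> //.
    apply/(sat_compat (e := env_cons _ _) erefl iw).
    by split=> j; rewrite size_mkseq => jb; rewrite sE.
  move=> A' B' mA mB; apply: hb => n nb.
    by rewrite -(sE A) // mA // size_mkseq.
  by rewrite -(sE B) // mB // size_mkseq.
have sat0E z : G i A B z -> exists w, sat (env_cons w (env_cons z e)) E (tab 0).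
  move=> Gz; have [w [sa [sb [iw cw h]]]] := ex_info z.
  exists w; apply/satS; split=> //; exists i, z; split=> //.
  by exists sa, sb; split=> // A' B' mA mB; apply/(h _ _ mA mB).
have sat1E z : ~ G i A B z -> exists w, sat (env_cons w (env_cons z e)) E (tab 1).
  move=> Gz; have [w [sa [sb [iw cw h]]]] := ex_info z.
  exists w; apply/satS; split=> //; exists i, z; split=> //.
  by exists sa, sb; split=> // A' B' mA mB /(h _ _ mA mB).
have [|||z|X MX XE] := comp (FEx (tab 0)) (FAll (FNot (tab 1))) e E.
- by exists (tab 0).
- by exists (FNot (tab 1)).
- exact: ME.
- split=> [[w /sat0 Gz] v /sat1 //|h].
  by apply: sat0E; apply: contrapT => /sat1E[w]; apply: h.
suff <- : X = G i A B by [].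
apply/seteqP; split=> z; first by move/XE => [w /sat0].
by move/sat0E => h; apply/XE.
Qed.

End UsePrinciple.

(** A total decoding is required, since the use condition also concerns sets that are not graphs;
    these give a least value or 0. *)
Definition gfun (X : set nat) (i : nat) : nat :=
  if pselect (exists y, `[<X (npair i y)>]) is left h then ex_minn h else 0.

Definition graph (f : nat -> nat) : set nat := range (fun i => npair i (f i)).

Lemma graphE f i y : graph f (npair i y) <-> y = f i.
Proof.
split=> [[j _ /npair_inj[-> ->]]|->] //; by exists i.
Qed.

Lemma gfunE f i X : agree (npair i (f i)).+1 (graph f) X -> gfun X i = f i.
Proof.
move=> ag; have Xf : `[<X (npair i (f i))>].
  by apply/asboolP; apply/(ag _ (leqnn _)); apply/graphE.
rewrite /gfun; case: pselect => [h|[]]; last by exists (f i).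
case: ex_minnP => y /asboolP Xy miny; have yf := miny _ Xf.
by apply/graphE; apply/ag => //; rewrite ltnS /npair; nia.
Qed.

(** One oracle serves all indices [i]; this uniformity allows parameters that depend on the
    model. *)
Lemma fun_use_oracle (I : countType) (Phi : I -> (nat -> nat) -> nat -> nat) :
  exists Y : set nat, forall M, RCA0 M -> M Y -> forall i f, fun_in M f ->
  (forall j, exists b, forall f', (forall k, k < b -> f' k = f k) ->
     Phi i f' j = Phi i f j) ->
  fun_in M (Phi i f).
Proof.
pose G i (A B : set nat) := graph (Phi i (gfun A)).
exists (use_oracle G) => M hM MY i f Mf use.
have ef : gfun (graph f) = f by apply/funext => k; apply: gfunE.
have -> : fun_in M (Phi i f) = M (G i (graph f) set0) by rewrite /G ef.
have M0 : M (graph f) by [].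
suff : M (G i (graph f) (graph f)) by [].
apply: use_oracleP => // z; rewrite /G ef.
have [b hb] : exists b, forall A', agree b (graph f) A' ->
    forall k y, z = npair k y -> Phi i (gfun A') k = Phi i f k.
  case: (pselect (exists k y, z = npair k y)) => [[k [y ->]]|no]; last first.
    by exists 0 => A' _ k y e; case: no; exists k, y.
  have [b hb] := use k.
  (* Agreement with the graph up to these pairs fixes all values of [gfun] at arguments below
     [b]. *)
  exists (\max_(l < b) (npair l (f l)).+1) => A' ag k' y' /npair_inj[<- _].
  apply: hb => l lb; apply: gfunE; apply: agree_leq ag.
  exact: (@leq_bigmax _ (fun l : 'I_b => (npair l (f l)).+1) (Ordinal lb)).
exists b => A' _ /hb h _; split=> -[k _ e].
  by exists k => //; rewrite -(h k _ (esym e)).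
by exists k => //; rewrite (h k _ (esym e)).
Qed.

Definition next_change (g : nat -> nat) (l : nat) : nat :=
  if pselect (exists k, (l < k) && (g k != g l)) is left h then ex_minn h else l.

Lemma next_changeP g l : (exists2 k, l < k & g k <> g l) ->
  [/\ l < next_change g l, g (next_change g l) <> g l &
      forall k, l < k -> g k <> g l -> next_change g l <= k].
Proof.
move=> [k lk /eqP gk]; rewrite /next_change.
case: pselect => [h|[]]; last by exists k; rewrite lk.
case: ex_minnP => m /andP[lm /eqP gm] minm; split=> // k' lk' /eqP gk'.
by apply: minm; rewrite lk'.
Qed.

Lemma next_change_ext g g' l : (exists2 k, l < k & g k <> g l) ->
  (forall k, k <= next_change g l -> g' k = g k) ->
  next_change g' l = next_change g l.
Proof.
move=> /next_changeP[lt ne mn] ext.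
have [] := @next_changeP g' l.
  by exists (next_change g l); rewrite ?ext // ltnW.
move=> lt' ne' mn'.
have le : next_change g' l <= next_change g l by apply: mn'; rewrite ?ext // ltnW.
apply/eqP; rewrite eqn_leq le; apply: mn => //.
by rewrite -!ext // ltnW // (leq_trans lt').
Qed.

(* Otherwise, selecting the places where the function changes yields a descending
   sequence in [R] that belongs to the model. *)
Lemma thin_oracle (I : countType) (pi : I -> nat -> nat) :
  exists Y : set nat, forall M, RCA0 M -> M Y -> forall i f R n, fun_in M f ->
  wf_in M R ->
  (forall k l, n <= k -> k < l -> pi i (f k) <> pi i (f l) ->
     strict R (pi i (f l)) (pi i (f k))) ->
  exists2 k, n <= k & forall l, k < l -> pi i (f l) = pi i (f k).
Proof.
pose Phi (i : I * nat) f j :=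
  pi i.1 (f (iter j (next_change (pi i.1 \o f)) i.2)).
have [Y hY] := fun_use_oracle Phi; exists Y => M hM MY i f R n Mf wf dec.
apply: contrapT => no.
have ch k : n <= k -> exists2 l, k < l & (pi i \o f) l <> (pi i \o f) k.
  move=> nk; apply: contrapT => nc; apply: no; exists k => // l kl.
  by apply: contrapT => e; apply: nc; exists l.
have ge j : n <= iter j (next_change (pi i \o f)) n.
  elim: j => // j ih; rewrite iterS.
  by have [lt _ _] := next_changeP (ch _ ih); apply: leq_trans ih (ltnW lt).
apply: wf; exists (Phi (i, n) f); last first.
  move=> j; rewrite /Phi iterS /=.
  have [lt ne _] := next_changeP (ch _ (ge j)).
  by apply: dec => // e; apply: ne.
apply: hY => // j.
(* Each iterate inspects only finitely many values; the bound must also cover the place where [f] is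
   finally evaluated. *)
suff [b [lb hb]] : exists b, iter j (next_change (pi i \o f)) n < b /\
    forall f', (forall k, k < b -> f' k = f k) ->
    iter j (next_change (pi i \o f')) n = iter j (next_change (pi i \o f)) n.
  by exists b => f' ext; rewrite /Phi /= hb // ext.
elim: j => [|j [b [lb hb]]]; first by exists n.+1.
pose l := iter j (next_change (pi i \o f)) n.
exists (maxn b (next_change (pi i \o f) l).+1); split.
  by rewrite iterS leq_maxr.
move=> f' ext; rewrite !iterS hb; last first.
  by move=> k kb; apply: ext; rewrite leq_max kb.
apply: next_change_ext => [|k hk /=]; first exact: ch (ge j).
by rewrite ext // leq_max ltnS hk orbT.
Qed.

Lemma join_oracle (Y1 Y2 : set nat) : exists Y : set nat, forall M, RCA0 M ->
  M Y -> M Y1 /\ M Y2.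
Proof.
exists (fun n => (exists2 m, n = npair 0 m & Y1 m) \/ (exists2 m, n = npair 1 m & Y2 m)).
set Y := fun n => _ => M [_ [_ comp]] MY.
have sec t (X : set nat) : (forall m, Y (npair t m) <-> X m) -> M X.
  move=> YX; pose phi := FIn (tpair (tnum t) (TVar 1)) 0.
  have sphi n w e : sat (env_cons w (env_cons n e)) (fun=> Y) phi <-> X n.
    rewrite -YX; have <- : teval (env_cons w (env_cons n e)) (tpair (tnum t) (TVar 1)) =
      npair t n by rewrite teval_tpair teval_tnum.
    by [].
  have [|||n|Z MZ ZE] := comp (FEx phi) (FAll phi) (fun=> 0) (fun=> Y).
  - by exists phi.
  - by exists phi.
  - by [].
  - split=> [[w /sphi h] v|h]; first exact/sphi.
    by exists 0; apply: h.
  suff <- : Z = X by [].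
  apply/seteqP; split=> n; first by move/ZE => [w /sphi].
  by move=> h; apply/ZE; exists 0; apply/sphi.
split; [apply: (sec 0)|apply: (sec 1)] => m; split.
- by case=> -[m' /npair_inj[// _ ->]].
- by move=> h; left; exists m.
- by case=> -[m' /npair_inj[// _ ->]].
- by move=> h; right; exists m.
Qed.

(** * Paths from descending sequences *)

Lemma linear_omega_squared : linear_order omega_squared.
Proof.
split.
- move=> x y [m [n [m' [n' [-> -> _]]]]]; split.
    by exists m, n, m, n; split=> //; right.
  by exists m', n', m', n'; split=> //; right.
- move=> x y [m [n [m' [n' [-> -> h]]]]] [k [l [k' [l' [e1 e2 h']]]]].
  by move/npair_inj: e1 e2 => [? ?] /npair_inj[? ?]; subst; congr npair; lia.
- move=> x y z [m [n [m' [n' [-> -> h]]]]] [k [l [k' [l' [e -> h']]]]].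
  by move/npair_inj: e => [? ?]; subst; exists m, n, k', l'; split=> //; lia.
- move=> x y [m [n [_ [_ [-> _ _]]]]] [m' [n' [_ [_ [-> _ _]]]]].
  case: (pselect (m < m' \/ m = m' /\ n <= n')) => h.
    by left; exists m, n, m', n'.
  by right; exists m', n', m, n; split=> //; lia.
Qed.

Lemma omega_squaredE m n m' n' :
  omega_squared (npair m n) (npair m' n') <-> m < m' \/ m = m' /\ n <= n'.
Proof.
split; last by move=> h; exists m, n, m', n'.
by move=> [k [l [k' [l' [/npair_inj[? ?] /npair_inj[? ?] h]]]]]; subst.
Qed.

Section HasPath.
Variable D : set nat.

(* The variables [v i 0], ..., [v i (i - 1)] of the term [sg i] are listed in the
   order of precedence; [L] is their order as elements of a linear order. *)
Definition has_path : Prop :=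
  exists (sg ar : nat -> nat) (v : nat -> nat -> nat) (L : nat -> nat -> bool),
  [/\ forall i, full D (sg i) (ar i),
      forall i j, j < i -> v i j < ar i,
      forall i j j', j < i -> j' < i -> (v i j <= v i j') = L j j',
      forall i j j', j < i -> j' < i -> v i j = v i j' -> j = j' &
      forall i i' j g h, j < i -> j < i' -> sorted ltn g -> size g = ar i ->
        sorted ltn h -> size h = ar i' ->
        (forall j', j' < j -> nth 0 g (v i j') = nth 0 h (v i' j')) ->
        nth 0 g (v i j) < nth 0 h (v i' j) -> ~ tle D (sg i') h (sg i) g].

Definition frozen (s : nat) (a F : seq nat) : fterm :=
  FTerm s (size a) [seq index x a | x <- F].

(* The value in [a] of the leading variable of the element [(s, a)] of
   [Dbar R] coded by [d], when the elements of [F] are frozen. *)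
Definition leading (F : seq nat) (d : nat) : nat :=
  xget 0 [set x | exists s a p, [/\ d = npair s (code a),
    fdom D (frozen s a F) (Some p) & x = nth 0 a p]].

(** The choice made in [leading] may return a position other than [p0]. *)
Lemma leadingE F s a p0 : fdom D (frozen s a F) (Some p0) ->
  exists2 p, fdom D (frozen s a F) (Some p) & leading F (npair s (code a)) = nth 0 a p.
Proof.
move=> dp; rewrite /leading; case: xgetP => [x _ [s' [a' [p [e dp' ->]]]]|no].
  by have [? /code_inj ?] := npair_inj e; subst s' a'; exists p.
by case: (no (nth 0 a p0)); exists s, a, p0.
Qed.

Section NoPath.
Hypothesis hD : predilator D.
Hypothesis hwf : wf_in setT (Dbar D omega_squared).
Variable R : nat -> nat -> Prop.
Hypothesis hR : linear_order R.

Lemma Dbar_strict_trans s a t b r c :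
  Dbar_elt D R s a -> Dbar_elt D R t b -> Dbar_elt D R r c ->
  strict (Dbar D R) (npair s (code a)) (npair t (code b)) ->
  strict (Dbar D R) (npair t (code b)) (npair r (code c)) ->
  strict (Dbar D R) (npair s (code a)) (npair r (code c)).
Proof.
move=> es et er; have [ia _ _] := es; have [ib _ _] := et; have [ic _ _] := er.
have [u iu eu] := increasing_union hR ia ib.
have [w iw ew] := increasing_union hR iu ic.
have aw : {subset a <= w} by move=> x xa; rewrite ew mem_cat eu mem_cat xa.
have bw : {subset b <= w} by move=> x xb; rewrite ew mem_cat eu mem_cat xb orbT.
have cw : {subset c <= w} by move=> x xc; rewrite ew mem_cat xc orbT.
have sa := sorted_incl hR iw aw ia; have sb := sorted_incl hR iw bw ib.
have sc := sorted_incl hR iw cw ic.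
have ta : tm D s (incl w a) by apply: tm_elt es _ sa; rewrite size_map.
have tb : tm D t (incl w b) by apply: tm_elt et _ sb; rewrite size_map.
have tc : tm D r (incl w c) by apply: tm_elt er _ sc; rewrite size_map.
rewrite (Dbar_strict hD hR es et sa sb (pat_incl hR iw aw bw)) => h1.
rewrite (Dbar_strict hD hR et er sb sc (pat_incl hR iw bw cw)) => h2.
apply/(Dbar_strict hD hR es er sa sc (pat_incl hR iw aw cw)) => h3.
by apply: h2; apply: (tle_trans hD tc ta tb h3); apply: (tlt_le hD ta tb h1).
Qed.

Lemma pat_vals F s a t b g h : increasing R a -> increasing R b ->
  {subset F <= a} -> {subset F <= b} -> sorted ltn g -> sorted ltn h ->
  pat R a b g h -> [/\ placed (frozen s a F) g, placed (frozen t b F) h &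
    vals (frozen s a F) g = vals (frozen t b F) h].
Proof.
move=> ia ib Fa Fb sg sh [sag sbh pt]; split; [by []|by []|].
rewrite /vals /= -!map_comp; apply/eq_in_map => x xF /=.
have hi : index x a < size a by rewrite index_mem Fa.
have hj : index x b < size b by rewrite index_mem Fb.
have [p1 p2] := pt _ _ hi hj; rewrite !nth_index ?Fa ?Fb // in p1 p2.
have := increasing_refl ia hi; rewrite nth_index ?Fa // => r.
by apply/eqP; rewrite eqn_leq; apply/andP; split; [apply/p1|apply/p2].
Qed.

Lemma okf_frozen F s a : Dbar_elt D R s a -> {subset F <= a} -> okf D (frozen s a F).
Proof.
move=> [_ h1 h2] Fa; split=> //; apply/allP => y /mapP[x /Fa xa ->] /=.
by rewrite index_mem.
Qed.

Lemma fcompat_frozen F s a t b : increasing R a -> increasing R b ->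
  {subset F <= a} -> {subset F <= b} -> fcompat (frozen s a F) (frozen t b F).
Proof.
move=> ia ib Fa Fb; split; rewrite !size_map // => i j hi hj.
have ord c : increasing R c -> {subset F <= c} ->
    (index (nth 0 F i) c <= index (nth 0 F j) c) = `[<R (nth 0 F i) (nth 0 F j)>].
  move=> ic Fc; have ci : nth 0 F i \in c by rewrite Fc ?mem_nth.
  have cj : nth 0 F j \in c by rewrite Fc ?mem_nth.
  have := @increasing_le _ hR c (index (nth 0 F i) c) (index (nth 0 F j) c) ic.
  rewrite !index_mem !nth_index // => /(_ ci cj) E.
  by apply/idP/asboolP => /E.
by rewrite !(nth_map 0) // !ord.
Qed.

Section Descending.
Variables (s : nat -> nat) (a : nat -> seq nat).
Hypothesis elt : forall l, Dbar_elt D R (s l) (a l).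

Definition below_chain F k : Prop := forall l, k <= l -> exists2 l', l < l' &
  below D (frozen (s l') (a l') F) (frozen (s l) (a l) F).

(* An infinite chain for [below] can be placed into [omega^2], with the frozen
   variables at fixed limit positions. *)
Lemma no_below_chain F k : (forall l, k <= l -> {subset F <= a l}) ->
  ~ below_chain F k.
Proof.
move=> Fa chain.
have /choice[nx hnx] : forall l, exists l', k <= l -> l < l' /\
    below D (frozen (s l') (a l') F) (frozen (s l) (a l) F).
  move=> l; case: (leqP k l) => kl; last by exists 0.
  by have [l' lt b] := chain l kl; exists l'.
pose lam i := iter i nx k.
have klam i : k <= lam i.
  by elim: i => //= i ih; apply: (leq_trans ih); apply/ltnW/(hnx _ ih).1.
pose X l := frozen (s l) (a l) F.
(* Frozen variables get offset 0 in their copy of omega, the others positive offsets. In [num] the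
   copies of omega are replaced by blocks of length [N], because [below] speaks of natural
   numbers. *)
pose off l p := if p \in ft_F (X l) then 0 else p.+1.
pose b l := mkseq (fun p => npair (cell (ft_F (X l)) p) (off l p)) (size (a l)).
pose num N l := mkseq (fun p => cell (ft_F (X l)) p * N + off l p) (size (a l)).
have off_le l p : off l p <= p.+1 by rewrite /off; case: ifP.
have lex_lt l p q : p < q -> cell (ft_F (X l)) p < cell (ft_F (X l)) q \/
    cell (ft_F (X l)) p = cell (ft_F (X l)) q /\ off l p < off l q.
  move=> pq; have := cell_leq (ft_F (X l)) (ltnW pq); rewrite leq_eqVlt.
  case/orP => [/eqP e|lt]; [right; split=> //|by left].
  have qF : q \notin ft_F (X l) by apply/negP => /cell_ltn/(_ pq); rewrite e ltnn.
  by apply: leq_ltn_trans (off_le _ _) _; rewrite /off (negbTE qF) ltnS.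
have eltb l : k <= l -> Dbar_elt D omega_squared (s l) (b l).
  move=> kl; have [_ h1 h2] := elt l; rewrite /Dbar_elt size_mkseq; split=> //.
  have le p q : p <= q -> q < size (a l) -> omega_squared (nth 0 (b l) p) (nth 0 (b l) q).
    move=> pq hq; rewrite !nth_mkseq //; last exact: leq_ltn_trans hq.
    apply/omega_squaredE; move: pq; rewrite leq_eqVlt => /orP[/eqP->|/(lex_lt l)]; lia.
  split; last by rewrite size_mkseq.
  apply/(uniqP 0) => p q; rewrite !inE size_mkseq => hp hq.
  rewrite !nth_mkseq // => /npair_inj[e1 e2].
  by case: (ltngtP p q) => // /(lex_lt l); lia.
apply: hwf; exists (fun i => npair (s (lam i)) (code (b (lam i)))) => // i.
pose l := lam i; have -> : lam i.+1 = nx l by [].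
have kl : k <= l by apply: klam.
have [_ bl] := hnx l kl.
have knl : k <= nx l by have := klam i.+1.
pose N := (maxn (size (a l)) (size (a (nx l)))).+2.
have snum l' : size (a l') <= maxn (size (a l)) (size (a (nx l))) -> sorted ltn (num N l').
  move=> hl; apply: nth_sorted_ltn => p q pq; rewrite size_mkseq => hq.
  have hp := ltn_trans pq hq; rewrite !nth_mkseq //.
  have := lex_lt l' p q pq; have := off_le l' p; rewrite /N; nia.
have sl := snum l (leq_maxl _ _); have snl := snum (nx l) (leq_maxr _ _).
have pt : pat omega_squared (b (nx l)) (b l) (num N (nx l)) (num N l).
  split; rewrite ?size_mkseq // => p q hp hq.
  rewrite !nth_mkseq // !omega_squaredE.
  have := off_le (nx l) p; have := off_le l q.
  have pN : p.+1 < N by rewrite /N; lia.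
  have qN : q.+1 < N by rewrite /N; lia.
  move: (cell _ p) (cell _ q) (off _ p) (off _ q) => c1 c2 o1 o2 h1 h2.
  by split; split; nia.
apply/(Dbar_strict hD linear_omega_squared (eltb _ knl) (eltb _ kl) snl sl pt).
apply: bl; [by rewrite /placed size_mkseq|by rewrite /placed size_mkseq|].
rewrite /vals /= -!map_comp; apply/eq_in_map => x xF /=.
have mF l' : index x (a l') \in ft_F (X l') by apply: (map_f (index^~ (a l')) xF).
rewrite !nth_mkseq ?index_mem ?Fa // /off !mF !addn0; congr (_ * _).
have [ia _ _] := elt (nx l); have [ia' _ _] := elt l.
have [e1 e2] := fcompat_frozen (s (nx l)) (s l) ia ia' (Fa _ knl) (Fa _ kl).
rewrite !cell_iota -[size (ft_F (X l))]e1; apply: eq_in_count => j.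
rewrite mem_iota => /andP[_ hj].
have [m hm ex] : exists2 m, m < size F & x = nth 0 F m by move/(nthP 0): xF => [m hm <-]; exists m.
have := e2 j m hj; rewrite ?size_map => /(_ hm) /=.
by rewrite !(nth_map 0 0 _ hm) -ex.
Qed.

Definition decides F l l' j : Prop := forall g h,
  sorted ltn g -> size g = size (a l) -> sorted ltn h -> size h = size (a l') ->
  (forall j', j' < j -> nth 0 g (index (nth 0 F j') (a l)) =
                        nth 0 h (index (nth 0 F j') (a l'))) ->
  nth 0 g (index (nth 0 F j) (a l)) < nth 0 h (index (nth 0 F j) (a l')) ->
  ~ tle D (s l') h (s l) g.

Hypothesis desc : forall l,
  strict (Dbar D R) (npair (s l.+1) (code (a l.+1))) (npair (s l) (code (a l))).

Lemma desc_lt l l' : l < l' ->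
  strict (Dbar D R) (npair (s l') (code (a l'))) (npair (s l) (code (a l))).
Proof.
elim: l' => // l' ih; rewrite ltnS leq_eqVlt => /orP[/eqP->|/ih h]; first exact: desc.
exact: Dbar_strict_trans (desc _) h.
Qed.

Lemma desc_placed F l l' : l < l' -> {subset F <= a l} -> {subset F <= a l'} ->
  exists g h, [/\ placed (frozen (s l') (a l') F) g, placed (frozen (s l) (a l) F) h,
    vals (frozen (s l') (a l') F) g = vals (frozen (s l) (a l) F) h,
    flt D (frozen (s l') (a l') F) g (frozen (s l) (a l) F) h & pat R (a l') (a l) g h].
Proof.
move=> ll' Fl Fl'; have [ia _ _] := elt l'; have [ib _ _] := elt l.
have [g [h [sg sh pt]]] := pat_exists hR ia ib; exists g, h.
have [pg ph e] := pat_vals (s l') (s l) ia ib Fl' Fl sg sh pt; split=> //.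
by apply/(Dbar_strict hD hR (elt l') (elt l) sg sh pt)/desc_lt.
Qed.

(** As there is no infinite chain, some term [k1] has no later term below it. All later terms are
    then comparable with [k1] through their leading variables, and [compared_trans] compares them
    with each other. *)
Lemma leading_decreasing F k : (forall l, k <= l -> {subset F <= a l}) ->
  exists k1, [/\ k <= k1,
    forall l, k1 < l -> exists2 p, fdom D (frozen (s l) (a l) F) (Some p) &
      leading F (npair (s l) (code (a l))) = nth 0 (a l) p,
    forall l l', k1 < l -> l < l' ->
      leading F (npair (s l) (code (a l))) <> leading F (npair (s l') (code (a l'))) ->
      strict R (leading F (npair (s l') (code (a l'))))
               (leading F (npair (s l) (code (a l)))) &
    forall l l' g h p p', k1 < l -> k1 < l' ->
      leading F (npair (s l) (code (a l))) = nth 0 (a l) p -> p < size (a l) ->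
      leading F (npair (s l') (code (a l'))) = nth 0 (a l') p' -> p' < size (a l') ->
      placed (frozen (s l) (a l) F) g -> placed (frozen (s l') (a l') F) h ->
      vals (frozen (s l) (a l) F) g = vals (frozen (s l') (a l') F) h ->
      nth 0 g p < nth 0 h p' ->
      flt D (frozen (s l) (a l) F) g (frozen (s l') (a l') F) h].
Proof.
move=> Fa; have [k1 kk1 hk1] : exists2 k1, k <= k1 & forall l, k1 < l ->
    ~ below D (frozen (s l) (a l) F) (frozen (s k1) (a k1) F).
  apply: contrapT => no; apply: (@no_below_chain F k Fa) => l kl.
  apply: contrapT => nl; apply: no; exists l => // l' ll' b; apply: nl; by exists l'.
pose X l := frozen (s l) (a l) F.
have ok l : k <= l -> okf D (X l) by move=> kl; apply: okf_frozen (elt l) (Fa l kl).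
have inc l : increasing R (a l) by have [] := elt l.
have cmp l l' : k <= l -> k <= l' -> fcompat (X l) (X l').
  by move=> kl kl'; apply: fcompat_frozen; auto.
have [oq dq] := fdom_exists hD (ok k1 kk1).
have kl l : k1 < l -> k <= l by move=> h; apply: leq_trans kk1 (ltnW h).
have [q [eq hq]] : exists q, oq = Some q /\ forall l, k1 < l ->
    exists p, [/\ fdom D (X l) (Some p),
      leading F (npair (s l) (code (a l))) = nth 0 (a l) p,
      cell (ft_F (X l)) p = cell (ft_F (X k1)) q & compared_at D (X l) p (X k1) q].
  have main l : k1 < l -> exists p q, [/\ oq = Some q, fdom D (X l) (Some p),
      leading F (npair (s l) (code (a l))) = nth 0 (a l) p &
      cell (ft_F (X l)) p = cell (ft_F (X k1)) q /\ compared_at D (X l) p (X k1) q].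
    move=> h; have [op dp] := fdom_exists hD (ok l (kl l h)).
    have [g [h' [pg ph e lt _]]] := desc_placed h (Fa _ kk1) (Fa _ (kl l h)).
    have cc := comparable_terms hD (ok _ (kl l h)) (ok _ kk1) (cmp _ _ (kl l h) kk1) _ dq
      (hk1 l h) pg ph e lt.
    (* The first use of [cc] shows that a leading variable exists, the second concerns the position
       that [leading] selects. *)
    have [p0 [_ [ep _ _ _]]] := cc op dp; subst op.
    have [p dp' ep] := leadingE dp.
    have [p' [q [[e1] e2 ec ca]]] := cc _ dp'; subst p'.
    by exists p, q.
  have [p0 [q [eq _ _ _]]] := main k1.+1 (ltnSn _); exists q; split=> // l /main.
  by rewrite eq => -[p [q' [[<-] dp ep [ec ca]]]]; exists p.
subst oq; have [qn qF _] := dq.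
have trans l l' g h p p' : k1 < l -> k1 < l' ->
      leading F (npair (s l) (code (a l))) = nth 0 (a l) p -> p < size (a l) ->
      leading F (npair (s l') (code (a l'))) = nth 0 (a l') p' -> p' < size (a l') ->
      placed (X l) g -> placed (X l') h -> vals (X l) g = vals (X l') h ->
      nth 0 g p < nth 0 h p' -> flt D (X l) g (X l') h.
  move=> hl hl' + pn + pn' pg ph e.
  have [p1 [[p1n p1F d1] -> c1 a1]] := hq l hl.
  have [p2 [[p2n p2F d2] -> c2 a2]] := hq l' hl'.
  have [ul _] := inc l; have [ul' _] := inc l'.
  move=> /eqP; rewrite nth_uniq // => /eqP <- /eqP; rewrite nth_uniq // => /eqP <-.
  apply: (compared_trans hD (ok _ (kl _ hl)) (ok _ (kl _ hl')) (ok _ kk1) _ p1n p2n qn p1F p2F qF) => //.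
  exact: cmp (kl _ hl) kk1.
exists k1; split=> //.
  by move=> l /hq[p [dp ep _ _]]; exists p.
move=> l l' hl ll'; have hl' := ltn_trans hl ll'.
have [p [[pn _ _] ep _ _]] := hq l hl; have [p' [[pn' _ _] ep' _ _]] := hq l' hl'.
have [g [h [pg ph e lt [_ _ pt]]]] := desc_placed ll' (Fa _ (kl _ hl)) (Fa _ (kl _ hl')).
have [pt1 pt2] := pt _ _ pn' pn.
rewrite ep ep' => ne; split; last by move=> e'; apply: ne; rewrite e'.
have [_ anti _ tot] := hR.
(* If the leading value rose strictly, [trans] would put the earlier term below the later one. *)
have [//|r] := tot _ _ (increasing_refl (inc l') pn') (increasing_refl (inc l) pn).
have le : nth 0 h p <= nth 0 g p' by apply/pt2.
case: (ltngtP (nth 0 h p) (nth 0 g p')) le => // [lt' _|e' _]; last by apply/pt1; rewrite e'.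
have lt2 := trans _ _ _ _ _ _ hl hl' ep pn ep' pn' ph pg (esym e) lt'.
by case: lt2; apply: (tlt_le hD) lt; apply: tm_placed; [apply: ok; apply: kl|..];
  try exact: ok (kl _ _); eassumption.
Qed.

End Descending.
End NoPath.
End HasPath.

Section PathOfDescent.
Variables (D : set nat) (hD : predilator D).
Hypothesis hwf : wf_in setT (Dbar D omega_squared).
Variable R : nat -> nat -> Prop.
Hypothesis hR : linear_order R.
Variables (s : nat -> nat) (a : nat -> seq nat).
Hypothesis elt : forall l, Dbar_elt D R (s l) (a l).
Hypothesis desc : forall l,
  strict (Dbar D R) (npair (s l.+1) (code (a l.+1))) (npair (s l) (code (a l))).
(** This is what well-foundedness in a model contributes; the rest of the argument takes place
    outside the model. *)
Hypothesis const_leading : forall F n,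
  (forall k l, n <= k -> k < l ->
    leading D F (npair (s k) (code (a k))) <> leading D F (npair (s l) (code (a l))) ->
    strict R (leading D F (npair (s l) (code (a l))))
             (leading D F (npair (s k) (code (a k))))) ->
  exists2 k, n <= k & forall l, k < l ->
    leading D F (npair (s l) (code (a l))) = leading D F (npair (s k) (code (a k))).

Definition deciding (st : seq nat * nat) : Prop :=
  [/\ forall l, st.2 <= l -> {subset st.1 <= a l}, uniq st.1 &
    forall l l' j, st.2 <= l -> st.2 <= l' -> j < size st.1 ->
      decides D s a st.1 l l' j].

Lemma deciding_step st : deciding st -> exists st', deciding st' /\
  exists2 x, st'.1 = rcons st.1 x & st.2 <= st'.2.
Proof.
case: st => F k [/= Fa uF dec].
have [k1 [kk1 dom dcr cmp]] := leading_decreasing hD hwf hR elt desc Fa.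
have [k2 k12 cst] := const_leading dcr.
pose x := leading D F (npair (s k2) (code (a k2))).
have xE l : k2 < l -> exists p, [/\ p < size (a l), nth 0 (a l) p = x,
    index x (a l) = p & leading D F (npair (s l) (code (a l))) = nth 0 (a l) p].
  move=> h; have [p [pn _ _] e] := dom l (ltn_trans k12 h).
  have [[ul _] _ _] := elt l; exists p; rewrite -e cst // -/x; split=> //.
  by rewrite -[x](cst _ h) e index_uniq.
have kl l : k2 < l -> k <= l.
  by move=> h; apply: leq_trans kk1 (ltnW (ltn_trans k12 h)).
have xa l : k2 < l -> x \in a l.
  by move=> /xE[p [pn <- _ _]]; rewrite mem_nth.
have xF : x \notin F.
  apply/negP => xF; have h := ltnSn k2; have [[ul _] _ _] := elt k2.+1.
  have [p [pn pF _] e] := dom _ (ltn_trans k12 h).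
  move/negP: pF; apply => /=; apply/mapP; exists x => //.
  by rewrite -[x](cst _ h) e index_uniq.
exists (rcons F x, k2.+1); split; last by exists x => //=; apply: kl.
split=> /=.
- by move=> l h y; rewrite mem_rcons inE => /orP[/eqP->|]; [apply: xa|apply: Fa; apply: kl].
- by rewrite rcons_uniq xF.
move=> l l' j hl hl'; rewrite size_rcons ltnS leq_eqVlt => /orP[/eqP ej|hj]; last first.
  move=> g h sg ng sh nh e; rewrite nth_rcons hj.
  apply: dec => // [||j' jj']; [exact: kl|exact: kl|].
  by have := e j' jj'; rewrite nth_rcons (ltn_trans jj' hj).
move=> g h sg ng sh nh; rewrite nth_rcons ej ltnn eqxx => e.
have [p [pn pe ip lp]] := xE l hl; have [p' [pn' pe' ip' lp']] := xE l' hl'.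
rewrite ip ip' => lt.
apply: (cmp l l' g h p p') => //; try exact: (ltn_trans k12).
rewrite /vals /= -!map_comp; apply/eq_in_map => y yF /=.
have := e (index y F); rewrite index_mem => /(_ yF).
by rewrite nth_rcons index_mem yF nth_index.
Qed.

Lemma path_of_descent : has_path D.
Proof.
have /choice[nx hnx] : forall st, exists st', deciding st -> deciding st' /\
    exists2 x, st'.1 = rcons st.1 x & st.2 <= st'.2.
  move=> st; case: (pselect (deciding st)) => [/deciding_step[st' h]|h]; first by exists st'.
  by exists st.
pose st i := iter i nx ([::], 0).
have dst i : deciding (st i).
  by elim: i => [|i ih]; [split|have [] := hnx _ ih].
pose F i := (st i).1; pose k i := (st i).2.
have sF i : size (F i) = i.
  elim: i => // i ih; have [_ [x e _]] := hnx _ (dst i).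
  by rewrite /F /= -/(st i) e size_rcons -/(F i) ih.
have kmon i i' : i <= i' -> k i <= k i'.
  elim: i' => [|i' ih]; first by rewrite leqn0 => /eqP->.
  rewrite leq_eqVlt ltnS => /orP[/eqP->//|/ih h].
  by have [_ [x _ le]] := hnx _ (dst i'); apply: leq_trans le.
have Fmon i i' j : i <= i' -> j < i -> nth 0 (F i') j = nth 0 (F i) j.
  elim: i' => [|i' ih]; first by rewrite leqn0 => /eqP->.
  rewrite leq_eqVlt ltnS => /orP[/eqP->//|ii' ji].
  have [_ [x e _]] := hnx _ (dst i').
  by rewrite {1}/F /= -/(st i') e nth_rcons -/(F i') sF (leq_trans ji ii') ih.
pose x j := nth 0 (F j.+1) j.
have xE i j : j < i -> nth 0 (F i) j = x j by move=> ji; rewrite (Fmon j.+1).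
have xa i j : j < i -> x j \in a (k i).
  by move=> ji; have [sub _ _] := dst i; apply: sub => //; rewrite -(xE i j ji) mem_nth ?sF.
have inc l : increasing R (a l) by have [] := elt l.
exists (fun i => s (k i)), (fun i => size (a (k i))),
  (fun i j => index (x j) (a (k i))), (fun j j' => `[<R (x j) (x j')>]); split.
- by move=> i; have [_ h1 h2] := elt (k i).
- by move=> i j ji; rewrite index_mem xa.
- move=> i j j' ji ji'.
  have := @increasing_le _ hR _ (index (x j) (a (k i))) (index (x j') (a (k i))) (inc (k i)).
  rewrite !index_mem !nth_index ?xa // => /(_ isT isT) E.
  by apply/idP/asboolP => /E.
- move=> i j j' ji ji' e; have [_ u _] := dst i.
  apply/eqP; rewrite -(nth_uniq 0 _ _ u) ?sF // !xE //.
  by rewrite -(nth_index 0 (xa i j ji)) e nth_index ?xa.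
move=> i i' j g h ji ji' sg ng sh nh e lt.
(* The shorter of the two lists already contains element [j] and decides both terms. *)
pose m := minn i i'; have jm : j < m by rewrite leq_min ji.
have [_ _ dec] := dst m.
have hm : k m <= k i by apply: kmon; rewrite geq_minl.
have hm' : k m <= k i' by apply: kmon; rewrite geq_minr.
apply: (dec (k i) (k i') j hm hm' _ g h) => //; first by rewrite sF.
  by move=> j' jj'; rewrite xE ?(ltn_trans jj') // e.
by rewrite xE.
Qed.

End PathOfDescent.

(** Leading values are read off from codes by [leading D], so [thin_oracle], with the finite list of
    frozen elements as index, supplies the eventual constancy. *)
Lemma dilator_of_no_path (D : set nat) : predilator D ->
  wf_in setT (Dbar D omega_squared) -> ~ has_path D ->
  omega_entails RCA0 dilator_in D.
Proof.
move=> hD hwf np; have [Y hY] := thin_oracle (leading D).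
exists Y => M hM _ MY; split=> // A _ hA wfA [f Mf desc]; apply: np.
have /choice[sa hsa] : forall l, exists sa : nat * seq nat,
    f l = npair sa.1 (code sa.2) /\ Dbar_elt D (coded_order A) sa.1 sa.2.
  move=> l; have [[s [a [t [b [_ e _ et _]]]]] _] := desc l.
  by exists (t, b).
apply: (@path_of_descent D hD hwf (coded_order A) hA (fun l => (sa l).1) (fun l => (sa l).2)).
- by move=> l; have [] := hsa l.
- by move=> l; have [e1 _] := hsa l; have [e2 _] := hsa l.+1; rewrite -e1 -e2.
move=> F n dec; have fE l : npair (sa l).1 (code (sa l).2) = f l by have [] := hsa l.
have [k l|k nk hk] := hY M hM MY F f (coded_order A) n Mf wfA.
  by have := dec k l; rewrite !fE.
by exists k => // l kl; rewrite !fE hk.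
Qed.

(** * Descending sequences from paths *)

Fixpoint tren (r : nat -> nat) (t : term) : term :=
  match t with
  | TVar k => TVar (r k)
  | TZero => TZero
  | TOne => TOne
  | TAdd t1 t2 => TAdd (tren r t1) (tren r t2)
  | TMul t1 t2 => TMul (tren r t1) (tren r t2)
  end.

Definition rlift (r : nat -> nat) (k : nat) : nat := if k is k'.+1 then (r k').+1 else 0.

Fixpoint fren (r : nat -> nat) (phi : formula) : formula :=
  match phi with
  | FEq t1 t2 => FEq (tren r t1) (tren r t2)
  | FLt t1 t2 => FLt (tren r t1) (tren r t2)
  | FIn t k => FIn (tren r t) k
  | FNot p => FNot (fren r p)
  | FAnd p q => FAnd (fren r p) (fren r q)
  | FOr p q => FOr (fren r p) (fren r q)
  | FImp p q => FImp (fren r p) (fren r q)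
  | FAllB t p => FAllB (tren r t) (fren (rlift r) p)
  | FExB t p => FExB (tren r t) (fren (rlift r) p)
  | FAll p => FAll (fren (rlift r) p)
  | FEx p => FEx (fren (rlift r) p)
  end.

Lemma teval_ren e r t : teval e (tren r t) = teval (e \o r) t.
Proof. by elim: t => //= t1 -> t2 ->. Qed.

Lemma env_cons_lift x e r : env_cons x e \o rlift r = env_cons x (e \o r).
Proof. by apply/funext => -[]. Qed.

Lemma sat_ren E phi : forall e r, sat e E (fren r phi) = sat (e \o r) E phi.
Proof.
elim: phi => [t1 t2|t1 t2|t k|p ih|p ihp q ihq|p ihp q ihq|p ihp q ihq|t p ih|t p ih|p ih|p ih] e r /=;
  rewrite ?teval_ren ?ih ?ihp ?ihq //.
- apply/propext; split=> h x hx; move: (h x hx); by rewrite ih env_cons_lift.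
- by apply/propext; split=> -[x hx h]; exists x => //; move: h; rewrite ih env_cons_lift.
- apply/propext; split=> h x; move: (h x); by rewrite ih env_cons_lift.
- by apply/propext; split=> -[x h]; exists x; move: h; rewrite ih env_cons_lift.
Qed.

Lemma bounded_ren phi : forall r, bounded (fren r phi) = bounded phi.
Proof. by elim: phi => //= [p ihp q ihq|p ihp q ihq|p ihp q ihq] r; rewrite ihp ihq. Qed.

Definition matrix_set (theta : formula) e E : set nat := fun z =>
  exists x n m, z = npair (npair x n) m /\
    sat (env_cons m (env_cons n (env_cons x e))) E theta.

Lemma matrix_setE theta e E x n m :
  matrix_set theta e E (npair (npair x n) m) <->
  sat (env_cons m (env_cons n (env_cons x e))) E theta.
Proof.
split; last by move=> h; exists x, n, m.
by move=> [x' [n' [m' [/npair_inj[/npair_inj[-> ->] ->]]]]].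
Qed.

Lemma matrix_set_in M theta e E : RCA0 M -> bounded theta -> (forall k, M (E k)) ->
  M (matrix_set theta e E).
Proof.
move=> [_ [_ comp]] bt ME.
(* In [phi] two further variables, the dummy [w] and the code [z], lie between the three variables
   of [theta] and the parameters. *)
pose r k := if k is k'.+3 then k'.+3.+2 else k.
pose phi := FExB (TAdd (TVar 1) TOne) (FExB (TAdd (TVar 2) TOne)
  (FExB (TAdd (TVar 3) TOne)
   (FAnd (FEq (TVar 4) (tpair (tpair (TVar 2) (TVar 1)) (TVar 0))) (fren r theta)))).
have bphi : bounded phi by rewrite /= bounded_ren.
have env x n m w z : env_cons m (env_cons n (env_cons x (env_cons w (env_cons z e)))) \o r =
    env_cons m (env_cons n (env_cons x e)) by apply/funext => -[|[|[|k]]].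
have theta_ren x n m w z : sat (env_cons m (env_cons n (env_cons x
    (env_cons w (env_cons z e))))) E (fren r theta) <->
    sat (env_cons m (env_cons n (env_cons x e))) E theta by rewrite sat_ren env.
have sphi w z : sat (env_cons w (env_cons z e)) E phi <-> matrix_set theta e E z.
  split.
    move=> [x _ [n _ [m _ [eq /theta_ren h]]]]; exists x, n, m.
    by split; [exact: eq|exact: h].
  move=> [x [n [m [-> h]]]].
  exists x; first by rewrite /= /npair; nia.
  exists n; first by rewrite /= /npair; nia.
  exists m; first by rewrite /= /npair; nia.
  by split; [rewrite /= /npair !mulnn|apply/theta_ren].
have [|||n|X MX XE] := comp (FEx phi) (FAll phi) e E.
- by exists phi.
- by exists phi.
- by [].
- split=> [[w /sphi h] v|h]; first exact/sphi.
  by exists 0; apply: h.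
suff <- : X = matrix_set theta e E by [].
apply/seteqP; split=> n; first by move/XE => [w /sphi].
by move=> h; apply/XE; exists 0; apply/sphi.
Qed.

(** * The order of sums of powers of two *)

Section Exp2.
Variable R : nat -> nat -> Prop.
Hypothesis hR : linear_order R.

Lemma exp2E u v : exp2 R u v <-> [/\ increasing R (rev (CodeSeq.decode u)),
  increasing R (rev (CodeSeq.decode v)) & lex R (CodeSeq.decode u) (CodeSeq.decode v)].
Proof.
split; first by move=> [s [t [-> -> h1 h2 h3]]]; rewrite /code !CodeSeq.codeK.
move=> [h1 h2 h3]; exists (CodeSeq.decode u), (CodeSeq.decode v).
by rewrite /code !CodeSeq.decodeK.
Qed.

Lemma lex_refl s : lex R s s.
Proof. by elim: s => //= x s ih; right. Qed.

Lemma lex_anti s t : lex R s t -> lex R t s -> s = t.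
Proof.
have [_ anti _ _] := hR.
elim: s t => [|x s ih] [|y t] //= [[r ne]|[-> h]] [[r' ne']|[e h']].
- by case: ne; apply: anti.
- by case: ne.
- by case: ne'.
- by rewrite (ih t).
Qed.

Lemma lex_trans s t w : lex R s t -> lex R t w -> lex R s w.
Proof.
have [_ anti tra _] := hR.
elim: s t w => [|x s ih] [|y t] [|z w] //= [[r ne]|[? h]] [[r' ne']|[? h']]; subst.
- by left; split; [apply: tra r r'|move=> e; subst z; apply: ne; apply: anti].
- by left.
- by left.
- by right; split=> //; apply: ih h h'.
Qed.

Lemma lex_total s t : {in s & t, forall x y, R x y \/ R y x} -> lex R s t \/ lex R t s.
Proof.
elim: s t => [|x s ih] [|y t] /= h; [by left|by left|by right|].
have [->|ne] := eqVneq x y.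
  have [a b ha hb|h'|h'] := ih t; [|by left; right|by right; right].
  by apply: h; rewrite inE ?ha ?hb orbT.
have [r|r] := h x y (mem_head _ _) (mem_head _ _).
  by left; left; split=> //; apply/eqP.
by right; left; split=> //; apply/eqP; rewrite eq_sym.
Qed.

Lemma linear_exp2 : linear_order (exp2 R).
Proof.
have [_ _ _ tot] := hR.
split.
- by move=> u v /exp2E[h1 h2 h3]; split; apply/exp2E; split=> //; apply: lex_refl.
- move=> u v /exp2E[h1 h2 h3] /exp2E[_ _ h4].
  by rewrite -(CodeSeq.decodeK u) (lex_anti h3 h4) CodeSeq.decodeK.
- move=> u v w /exp2E[h1 h2 h3] /exp2E[_ h4 h5]; apply/exp2E; split=> //.
  exact: lex_trans h3 h5.
- move=> u v /exp2E[h1 _ _] /exp2E[h2 _ _].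
  have fld a x : increasing R a -> x \in a -> R x x.
    by move=> ia /(nthP 0)[i hi <-]; apply: increasing_refl.
  have [x y hx hy|h|h] := @lex_total (CodeSeq.decode u) (CodeSeq.decode v).
  + by apply: tot; [apply: fld h1 _|apply: fld h2 _]; rewrite mem_rev.
  + by left; apply/exp2E.
  + by right; apply/exp2E.
Qed.

Variable f : nat -> nat.

Definition select (P : nat -> bool) (k n : nat) : seq nat :=
  [seq f j | j <- iota k n & P j].

(** Since [f] descends, smaller indices are larger exponents, so the first index where the
    selections differ decides. *)
Lemma lex_select (P P' : nat -> bool) k n :
  (forall i j, k <= i -> i < j -> j < k + n -> strict R (f j) (f i)) ->
  (exists j, [/\ k <= j, j < k + n, P' j, ~~ P j & forall i, k <= i -> i < j -> P i = P' i]) ->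
  lex R (select P k n) (select P' k n) /\ select P k n <> select P' k n.
Proof.
elim: n k => [|n ih] k dec [j [kj jn P'j nPj agr]]; first lia.
rewrite /select /=; have [e|ne] := eqVneq k j.
  subst j; rewrite P'j (negbTE nPj) /=.
  have hd x : x \in [seq f i | i <- iota k.+1 n & P i] -> strict R x (f k).
    move=> /mapP[i]; rewrite mem_filter mem_iota => /and3P[_ ki ikn] ->.
    by apply: dec => //; rewrite addnS.
  case: [seq f i | i <- iota k.+1 n & P i] hd => [|x l] hd //.
  have h := hd x (mem_head _ _); split; first by left.
  by move=> [e _]; case: h => _; apply.
have kj' : k < j by rewrite ltn_neqAle ne.
have [||ih1 ih2] := ih k.+1.
- by move=> i i' hi hij hj; apply: dec => //; [apply: ltnW|rewrite -addSnnS].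
- exists j; split=> //; first by rewrite addSnnS.
  by move=> i hi; apply: agr; apply: ltnW.
rewrite (agr k (leqnn k) kj'); case: (P' k) => //=.
by split; [right|move=> [e]].
Qed.

Lemma increasing_select P k n : (forall i, k <= i -> i < k + n -> R (f i) (f i)) ->
  (forall i j, k <= i -> i < j -> j < k + n -> strict R (f j) (f i)) ->
  increasing R (rev (select P k n)).
Proof.
move=> fld dec; have [_ anti _ _] := hR.
pose r := [rel x y | `[<strict R y x>]].
have pw : pairwise r (select P k n).
  rewrite /select; elim: n k fld dec => [|n ih] k fld dec //=.
  have rest : pairwise r [seq f j | j <- iota k.+1 n & P j].
    apply: ih => [i hi hin|i j hi ij hj]; [apply: fld|apply: dec] => //; try exact: ltnW;
    by rewrite -addSnnS.
  case: (P k) => //=; rewrite rest andbT; apply/allP => x /mapP[i].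
  rewrite mem_filter mem_iota => /and3P[_ ki ikn] ->; apply/asboolP.
  by apply: dec => //; rewrite -addSnnS.
have fl x : x \in select P k n -> R x x.
  by move=> /mapP[i]; rewrite mem_filter mem_iota => /and3P[_ ki ikn] ->; apply: fld.
have [_ _ tra _] := hR.
have tr : transitive r.
  move=> y x z /asboolP[r1 n1] /asboolP[r2 n2]; apply/asboolP.
  by split; [apply: tra r2 r1|move=> e; subst z; apply: n1; apply: anti].
have tr' : transitive (fun x y => r y x) by move=> y x z h1 h2; apply: tr h2 h1.
have pr : pairwise (fun x y => r y x) (rev (select P k n)).
  by rewrite -sorted_pairwise // rev_sorted sorted_pairwise.
move: (rev _) pr (fun x => fl x) (mem_rev (select P k n)) => l pr fl' me.
split.
  apply: (@pairwise_uniq _ (fun x y => r y x)) pr => x /=.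
  by apply/negbTE/asboolP => -[].
move=> i j; rewrite leq_eqVlt => /orP[/eqP->|ij] hj.
  by apply: fl; rewrite -me mem_nth.
have h := pairwiseP 0 pr i j.
by have /asboolP[] := h (ltn_trans ij hj) hj ij.
Qed.

End Exp2.

Section Near.
Variables A B : set nat.

(** Finite use: [P] holds in a neighbourhood of the pair of sets [A] and [B]. *)
Definition near (P : set nat -> set nat -> Prop) : Prop :=
  exists b, forall A' B', agree b A A' -> agree b B B' -> P A' B'.

Lemma near_and P Q : near P -> near Q -> near (fun A' B' => P A' B' /\ Q A' B').
Proof.
move=> [b hb] [c hc]; exists (maxn b c) => A' B' ha hb'.
split; [apply: hb|apply: hc]; by [apply: agree_leq ha; lia | apply: agree_leq hb'; lia].
Qed.

Lemma near_mono (P Q : set nat -> set nat -> Prop) :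
  (forall A' B', P A' B' -> Q A' B') -> near P -> near Q.
Proof. by move=> PQ [b hb]; exists b => A' B' h1 h2; apply/PQ/hb. Qed.

Lemma near_const (P : set nat -> set nat -> Prop) : (forall A' B', P A' B') -> near P.
Proof. by move=> h; exists 0. Qed.

Lemma near_all n (P : nat -> set nat -> set nat -> Prop) :
  (forall i, i < n -> near (P i)) -> near (fun A' B' => forall i, i < n -> P i A' B').
Proof.
elim: n => [|n ih] h; first exact: near_const.
have := near_and (ih (fun i hi => h i (ltnW hi))) (h n (ltnSn n)).
by apply: near_mono => A' B' [h1 h2] i; rewrite ltnS leq_eqVlt => /orP[/eqP->|/h1].
Qed.

Lemma near_left n : near (fun A' _ => A' n = A n).
Proof. by exists n.+1 => A' B' h _; apply/propext; apply: h. Qed.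

Lemma near_right n : near (fun _ B' => B' n = B n).
Proof. by exists n.+1 => A' B' _ h; apply/propext; apply: h. Qed.

Lemma near_strict x y :
  near (fun A' _ => strict (coded_order A') x y = strict (coded_order A) x y).
Proof.
by apply: near_mono (near_left (npair x y)) => A' _ h; rewrite /strict /coded_order h.
Qed.

Lemma near_increasing a :
  near (fun A' _ => increasing (coded_order A') a = increasing (coded_order A) a).
Proof.
have := near_all (fun i _ => near_all (n := size a) (fun j _ =>
  near_left (npair (nth 0 a i) (nth 0 a j)))) (n := size a).
apply: near_mono => A' _ h; apply/propext; rewrite /increasing /coded_order.
by split=> -[u r]; split=> // i j ij hj; move: (r i j ij hj); rewrite h //;
  apply: leq_ltn_trans hj.
Qed.

Lemma near_lex s t :
  near (fun A' _ => lex (coded_order A') s t = lex (coded_order A) s t).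
Proof.
elim: s t => [|x s ih] [|y t] /=; try exact: near_const.
by apply: near_mono (near_and (near_strict x y) (ih t)) => A' _ [-> ->].
Qed.

Lemma near_exp2 u v :
  near (fun A' _ => exp2 (coded_order A') u v = exp2 (coded_order A) u v).
Proof.
have := near_and (near_increasing (rev (CodeSeq.decode u))) (near_and
  (near_increasing (rev (CodeSeq.decode v))) (near_lex (CodeSeq.decode u) (CodeSeq.decode v))).
by apply: near_mono => A' _ [h1 [h2 h3]]; apply/propext; rewrite !exp2E h1 h2 h3.
Qed.

End Near.

(* A candidate [q] stands for a point [qy q] together with a witness [qn q] that
   the point fails to satisfy the given Pi02-formula. *)
Definition qy (q : nat) : nat := nth 0 (CodeSeq.decode q) 0.
Definition qn (q : nat) : nat := nth 0 (CodeSeq.decode q) 1.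

(** * Search by finite approximations *)

Section Greedy.
Variable ok : nat -> nat -> nat -> bool.

Definition cands s y := [seq q <- iota 0 s | ok s y q].

(** At stage [s], the least acceptable candidate is followed from each point; [f] is fuel. *)
Fixpoint greedy s f y : seq nat :=
  if f is f'.+1 then
    if cands s y is q :: _ then q :: greedy s f' (qy q) else [::]
  else [::].

Definition chain x0 s := greedy s s x0.

Fixpoint follows s y (w : seq nat) : bool :=
  if w is q :: w' then (ohead (cands s y) == Some q) && follows s (qy q) w' else true.

Lemma take_greedy s f y w : size w <= f ->
  (take (size w) (greedy s f y) == w) = follows s y w.
Proof.
elim: w f y => [|q w ih] [|f] y //=; first by rewrite take0.
rewrite ltnS => hf; case: (cands s y) => [|q' l] //=.
by rewrite eqseq_cons (inj_eq (@Some_inj _)); case: eqVneq => [->|] //=; apply: ih.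
Qed.

Lemma follows_rcons s y w q :
  follows s y (rcons w q) =
  follows s y w && (ohead (cands s (last y (map qy w))) == Some q).
Proof. by elim: w y => [|p w ih] y /=; rewrite ?andbT // ih andbA. Qed.

Lemma greedy_path (r : rel nat) s f y :
  (forall y' q, ok s y' q -> r y' (qy q)) -> path r y (map qy (greedy s f y)).
Proof.
move=> h; elim: f y => //= f ih y.
case e: (cands s y) => [|q l] //=; rewrite ih andbT; apply: h.
by have : q \in cands s y; [rewrite e mem_head|rewrite mem_filter => /andP[]].
Qed.

Lemma ohead_cands s y q : q < s -> ok s y q -> (forall p, p < q -> ~~ ok s y p) ->
  ohead (cands s y) = Some q.
Proof.
move=> qs okq no; rewrite /cands.
have -> : iota 0 s = iota 0 q ++ q :: iota q.+1 (s - q.+1).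
  by rewrite -[RHS]/(iota 0 q ++ iota (0 + q) (s - q.+1).+1) -iotaD; congr iota; lia.
rewrite filter_cat /= okq.
have -> // : [seq p <- iota 0 q | ok s y p] = [::].
apply/eqP; rewrite -size_eq0 size_filter -leqn0 leqNgt -has_count; apply/hasPn => p.
by rewrite mem_iota => /andP[_]; apply: no.
Qed.

Variable good : nat -> Prop.
Hypothesis ok_anti : forall s t y q, s <= t -> ok t y q -> ok s y q.
Hypothesis good_next : forall y, good y -> exists q, forall s, ok s y q.
Hypothesis ok_good : forall y q, (forall s, ok s y q) -> good (qy q).

(** Rejected candidates stay rejected. Once all candidates before the least permanent one are
    rejected, that one remains first. *)
Lemma ohead_limit y : good y -> exists q, good (qy q) /\
  exists s0, forall s, s0 <= s -> ohead (cands s y) = Some q.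
Proof.
move=> gy; have [q0 hq0] := good_next gy.
have ex : exists q, `[<forall s, ok s y q>] by exists q0; apply/asboolP.
case: (ex_minnP ex) => q /asboolP hq minq; exists q; split; first exact: ok_good hq.
have /choice[b hb] : forall p, exists s, p < q -> ~~ ok s y p.
  move=> p; apply: contrapT => no; have [pq|pq] := ltnP p q; last by apply: no; exists 0; lia.
  have /minq : `[<forall s, ok s y p>].
    by apply/asboolP => s; apply/negPn/negP => nok; apply: no; exists s.
  by rewrite leqNgt pq.
exists (maxn q.+1 (\max_(p < q) b p)) => s hs.
apply: ohead_cands => // [|p pq]; first by apply: leq_trans hs; rewrite leq_maxl.
apply: contra (hb p pq); apply: ok_anti; apply: leq_trans hs; rewrite leq_max; apply/orP; right.
exact: (@leq_bigmax _ (fun l : 'I_q => b l) (Ordinal pq)).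
Qed.

Lemma follows_limit y w : good y -> exists s0,
  (forall s, s0 <= s -> ~~ follows s y w) \/
  (good (last y (map qy w)) /\ forall s, s0 <= s -> follows s y w).
Proof.
elim: w y => [|q w ih] y gy; first by exists 0; right.
have [q' [gq' [s1 hs1]]] := ohead_limit gy.
have [->|ne] := eqVneq q q'; last first.
  exists s1; left => s hs /=; rewrite hs1 // (inj_eq (@Some_inj _)) eq_sym.
  by rewrite (negbTE ne).
have [s2 hs2] := ih _ gq'; exists (maxn s1 s2).
case: hs2 => [hs2|[gl hs2]]; [left|right; split=> //] => s; rewrite geq_max => /andP[h1 h2] /=.
  by rewrite negb_and hs2 // orbT.
by rewrite hs1 // eqxx hs2.
Qed.

End Greedy.

Section Changes.
Variable ch : nat -> seq nat.

(** A missing entry counts as changed, so some index changes at every stage, as [first_change]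
    requires. Stage 0 counts too, which makes [last_change] start at a valid value. *)
Definition changed i r : bool :=
  [|| size (ch r) <= i, r == 0 | take i.+1 (ch r) != take i.+1 (ch r.-1)].

Fixpoint last_change i s : nat :=
  if s is s'.+1 then if changed i s then s else last_change i s' else 0.

Definition valid (w : seq nat) r : bool :=
  (take (size w) (ch r) == w) && changed (size w) r.

Lemma unchangedP i s : ~~ changed i s.+1 -> [/\ i < size (ch s.+1), i < size (ch s),
  take i.+1 (ch s.+1) = take i.+1 (ch s), take i (ch s.+1) = take i (ch s)
  & last_change i s.+1 = last_change i s].
Proof.
move=> nc; move: (nc); rewrite /changed /= negb_or -ltnNge negbK => /andP[hi /eqP e].
split=> //; last by rewrite /= (negbTE nc).
  have := congr1 size e; rewrite size_takel // size_take_min => e'.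
  by rewrite [i.+1]e' geq_minr.
by have := congr1 (take i) e; rewrite !take_takel.
Qed.

Lemma last_changeP i s : i <= size (ch s) -> last_change i s <= s /\
  valid (take i (ch s)) (last_change i s).
Proof.
move=> hi; rewrite /valid (size_takel hi); elim: s hi => [|s ih] hi.
  by split=> //; rewrite /changed /= !eqxx /= orbT.
case c: (changed i s.+1); first by rewrite /= c leqnn eqxx.
have [_ hs _ e ->] := unchangedP (negbT c).
by rewrite e; have [h1 h2] := ih (ltnW hs); split=> //; apply: leq_trans h1 _.
Qed.

Lemma first_change s : exists j, [/\ j <= size (ch s), j <= size (ch s.+1),
  changed j s.+1, forall i, i < j -> ~~ changed i s.+1 &
  take j (ch s.+1) = take j (ch s)].
Proof.
have ex : exists j, changed j s.+1 by exists (size (ch s.+1)); rewrite /changed leqnn.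
case: (ex_minnP ex) => j cj minj; exists j.
have nc i : i < j -> ~~ changed i s.+1.
  by move=> ij; apply/negP => /minj; rewrite leqNgt ij.
case: j cj minj nc => [|j] cj minj nc; first by rewrite !take0.
by have [h1 h2 e _ _] := unchangedP (nc j (ltnSn j)).
Qed.

End Changes.

(** Either [w] is eventually abandoned, or it is eventually followed and its next entry settles as
    well. *)
Lemma valid_bounded (ok : nat -> nat -> nat -> bool) (good : nat -> Prop) x0 w :
  (forall s t y q, s <= t -> ok t y q -> ok s y q) ->
  (forall y, good y -> exists q, forall s, ok s y q) ->
  (forall y q, (forall s, ok s y q) -> good (qy q)) -> good x0 ->
  exists b, forall r, valid (chain ok x0) w r -> r < b.
Proof.
move=> h1 h2 h3 gx; have [b [hb|[gl hb]]] := follows_limit h1 h2 h3 w gx.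
  exists (maxn b (size w)) => r /andP[e _]; rewrite ltnNge geq_max; apply/negP => /andP[br wr].
  by have := hb r br; rewrite -(take_greedy ok r x0 wr) => /negP; apply.
have [q [_ [b' hb']]] := ohead_limit h1 h2 h3 gl.
(* The final successor keeps the preceding stage [r.-1] beyond the bounds as well. *)
exists (maxn (maxn b b') (size w).+1).+1 => r /andP[_ c]; rewrite ltnNge; apply/negP => hr.
have tk t : maxn (maxn b b') (size w).+1 <= t -> take (size w).+1 (chain ok x0 t) = rcons w q.
  rewrite !geq_max => /andP[/andP[tb tb'] tw].
  have := @take_greedy ok t t x0 (rcons w q); rewrite size_rcons => /(_ tw).
  by rewrite follows_rcons hb // hb' // eqxx => /eqP.
have e1 := tk r (ltnW hr); have e2 : take (size w).+1 (chain ok x0 r.-1) = rcons w q.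
  by apply: tk; move: hr; case: (r).
move: c; rewrite /changed e1 e2 eqxx orbF => /orP[|/eqP r0]; last by rewrite r0 in hr.
by have := congr1 size e1; rewrite size_take_min size_rcons; lia.
Qed.

Lemma changed_ext ch ch' i r : (forall t, t <= r -> ch' t = ch t) ->
  changed ch' i r = changed ch i r.
Proof. by move=> e; rewrite /changed !e // leq_pred. Qed.

Lemma valid_ext ch ch' w r : (forall t, t <= r -> ch' t = ch t) ->
  valid ch' w r = valid ch w r.
Proof. by move=> e; rewrite /valid e // (changed_ext _ e). Qed.

Lemma last_change_ext ch ch' i s : (forall t, t <= s -> ch' t = ch t) ->
  last_change ch' i s = last_change ch i s.
Proof.
elim: s => //= s ih e; rewrite (changed_ext _ e) ih // => t ts.
by apply: e; apply: leqW.
Qed.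

(** * The target order *)

Definition entry k x : nat := nth 0 (CodeSeq.decode x) k.

Lemma entry_code k l : entry k (code l) = nth 0 l k.
Proof. by rewrite /entry /code CodeSeq.codeK. Qed.

Lemma decode_code l : CodeSeq.decode (code l) = l.
Proof. exact: CodeSeq.codeK. Qed.

Lemma entryE a b c d : ((entry 0 (code [:: a; b; c; d]) = a) *
  (entry 1 (code [:: a; b; c; d]) = b) * (entry 2 (code [:: a; b; c; d]) = c) *
  (entry 3 (code [:: a; b; c; d]) = d))%type.
Proof. by rewrite !entry_code. Qed.

Section TargetOrder.
Variables (R : nat -> nat -> Prop) (ch : nat -> seq nat).
Hypothesis hR : linear_order R.

Definition target_elt x : Prop := [/\ size (CodeSeq.decode x) = 4,
  exp2 R (entry 0 x) (entry 0 x) & valid ch (CodeSeq.decode (entry 1 x)) (entry 2 x)].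

(* The third component records a stage of the approximation, and later stages
   come first; this preserves well-foundedness because only finitely many stages
   are valid for a given second component. *)
Definition target x y : Prop := [/\ target_elt x, target_elt y &
  strict (exp2 R) (entry 0 x) (entry 0 y) \/ entry 0 x = entry 0 y /\
  (entry 1 x < entry 1 y \/ entry 1 x = entry 1 y /\
  (entry 2 y < entry 2 x \/ entry 2 x = entry 2 y /\ entry 3 x <= entry 3 y))].

Lemma entry_inj x y : size (CodeSeq.decode x) = 4 -> size (CodeSeq.decode y) = 4 ->
  entry 0 x = entry 0 y -> entry 1 x = entry 1 y -> entry 2 x = entry 2 y ->
  entry 3 x = entry 3 y -> x = y.
Proof.
move=> sx sy e0 e1 e2 e3; rewrite -(CodeSeq.decodeK x) -(CodeSeq.decodeK y).
congr CodeSeq.code; apply: (@eq_from_nth _ 0); first by rewrite sx sy.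
by rewrite sx => -[|[|[|[|i]]]].
Qed.

Lemma target_refl x : target_elt x -> target x x.
Proof. by move=> h; split=> //; do 3 (right; split=> //). Qed.

Lemma linear_target : linear_order target.
Proof.
have [_ anti2 tra2 tot2] := linear_exp2 hR.
split.
- by move=> x y [hx hy _]; split; apply: target_refl.
- move=> x y [[sx _ _] [sy _ _] h1] [_ _ h2].
  have e0 : entry 0 x = entry 0 y.
    case: h1 => [[r ne]|[]//]; case: h2 => [[r' _]|[]//]; exact: anti2.
  have n0 : ~ strict (exp2 R) (entry 0 x) (entry 0 y) by move=> [_]; apply.
  have n0' : ~ strict (exp2 R) (entry 0 y) (entry 0 x) by move=> [_]; apply; rewrite e0.
  case: h1 => [//|[_ h1]]; case: h2 => [//|[_ h2]].
  by apply: entry_inj => //; lia.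
- move=> x y z [hx _ h1] [_ hz h2]; split=> //.
  case: h1 => [[r ne]|[e h1]]; case: h2 => [[r' ne']|[e' h2]].
  + left; split; first exact: tra2 r r'.
    by move=> e; apply: ne; apply: anti2 => //; rewrite e.
  + by left; rewrite -e'.
  + by left; rewrite e.
  + by right; rewrite e e'; split=> //; lia.
- move=> x y [hx _ _] [hy _ _]; have [_ fx _] := hx; have [_ fy _] := hy.
  have [e|/eqP ne] := eqVneq (entry 0 x) (entry 0 y).
    case: (pselect (entry 1 x < entry 1 y \/ entry 1 x = entry 1 y /\
      (entry 2 y < entry 2 x \/ entry 2 x = entry 2 y /\ entry 3 x <= entry 3 y))) => h.
      by left; split=> //; right.
    by right; split=> //; right; split=> //; lia.
  by have [r|r] := tot2 _ _ fx fy; [left|right]; split=> //; left; split=> // e; apply: ne.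
Qed.

End TargetOrder.

Lemma nat_stable (h : nat -> nat) n : (forall l, n <= l -> h l.+1 <= h l) ->
  exists2 m, n <= m & forall l, m <= l -> h l = h m.
Proof.
move=> dec.
have mon k l : n <= k -> k <= l -> h l <= h k.
  move=> nk; elim: l => [|l ih]; first by rewrite leqn0 => /eqP->.
  rewrite leq_eqVlt ltnS => /orP[/eqP->//|kl].
  by apply: leq_trans (ih kl); apply: dec; apply: leq_trans kl.
have ex : exists v, `[<exists2 m, n <= m & h m = v>] by exists (h n); apply/asboolP; exists n.
case: (ex_minnP ex) => v /asboolP[m nm <-] minv; exists m => // l ml.
apply/eqP; rewrite eqn_leq mon //; apply: minv; apply/asboolP.
by exists l => //; apply: leq_trans ml.
Qed.

(** The components stabilize one after another: the first by the thinning hypothesis, the second as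
    a natural number, the third because valid stages are bounded. Then the fourth would descend
    forever. *)
Lemma wf_target M R ch : linear_order R -> wf_in M (exp2 R) ->
  (forall w, exists b, forall r, valid ch w r -> r < b) ->
  (forall f, fun_in M f -> (forall k l, 0 <= k -> k < l -> entry 0 (f k) <> entry 0 (f l) ->
     strict (exp2 R) (entry 0 (f l)) (entry 0 (f k))) ->
   exists2 k, 0 <= k & forall l, k < l -> entry 0 (f l) = entry 0 (f k)) ->
  wf_in M (target R ch).
Proof.
move=> hR wf bnd thin [f Mf desc].
have [_ _ tra _] := linear_target ch hR.
have desc' k l : k < l -> target R ch (f l) (f k).
  elim: l => // l ih; rewrite ltnS leq_eqVlt => /orP[/eqP->|/ih h]; first by have [] := desc l.
  by have [h' _] := desc l; apply: tra h' h.
have [k _ hk] : exists2 k, 0 <= k & forall l, k < l -> entry 0 (f l) = entry 0 (f k).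
  apply: thin => // k l _ kl ne; have [_ _ [//|[e _]]] := desc' _ _ kl.
  by case: ne.
have c0 l l' : k < l -> k < l' -> entry 0 (f l) = entry 0 (f l').
  by move=> h h'; rewrite !hk.
have dec l : k < l -> entry 1 (f l.+1) < entry 1 (f l) \/ entry 1 (f l.+1) = entry 1 (f l) /\
    (entry 2 (f l) < entry 2 (f l.+1) \/
     entry 2 (f l.+1) = entry 2 (f l) /\ entry 3 (f l.+1) < entry 3 (f l)).
  move=> kl; have [[[s1 _ _] [s2 _ _] h] ne] := desc l.
  have e := c0 _ _ kl (ltnW kl : k < l.+1).
  case: h => [[_ []]|[_ h]]; first by rewrite e.
  have : entry 3 (f l.+1) <> entry 3 (f l) \/ entry 1 (f l.+1) <> entry 1 (f l) \/
      entry 2 (f l.+1) <> entry 2 (f l).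
    apply: contrapT => h'; apply: ne; apply: entry_inj; rewrite ?e //;
      by apply: contrapT => ne; apply: h'; auto.
  lia.
have [m1 km1 h1] := @nat_stable (fun l => entry 1 (f l)) k.+1
  (fun l kl => ltac:(have := dec l kl; lia)).
have [b hb] := bnd (CodeSeq.decode (entry 1 (f m1))).
have lt2 l : m1 <= l -> entry 2 (f l) < b.
  move=> ml; have [_ [_ _ v] _] := desc' l l.+1 (ltnSn l).
  by apply: hb; rewrite -(h1 l ml).
have [m2 m12 h2] : exists2 m2, m1 <= m2 & forall l, m2 <= l ->
    b - entry 2 (f l) = b - entry 2 (f m2).
  apply: (@nat_stable (fun l => b - entry 2 (f l))) => l ml.
  by have := dec l (leq_trans km1 ml); have := h1 l ml; have := h1 l.+1 (leqW ml); lia.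
have dec3 l : m2 <= l -> entry 3 (f l.+1) < entry 3 (f l).
  move=> ml; have := dec l (leq_trans km1 (leq_trans m12 ml)).
  have := h1 l (leq_trans m12 ml); have := h1 l.+1 (leqW (leq_trans m12 ml)).
  have := h2 l ml; have := h2 l.+1 (leqW ml).
  have := lt2 l (leq_trans m12 ml); have := lt2 l.+1 (leqW (leq_trans m12 ml)); lia.
have [m3 m23 h3] := @nat_stable (fun l => entry 3 (f l)) m2 (fun l ml => ltnW (dec3 l ml)).
by have := dec3 m3 m23; rewrite (h3 m3.+1 (leqnSn _)) ltnn.
Qed.

(** The last distinguished position at or before [p], if there is one. *)
Fixpoint base (vs : seq nat) (p : nat) : option nat :=
  if p \in vs then Some p else if p is p'.+1 then base vs p' else None.

Lemma base_in vs p b : base vs p = Some b -> b <= p /\ b \in vs.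
Proof.
elim: p => [|p ih] /=; case: ifP => // h; first by move=> [<-].
  by move=> [<-].
by move=> /ih[h1 h2]; split=> //; apply: leqW.
Qed.

Lemma base_mem vs p : p \in vs -> base vs p = Some p.
Proof. by case: p => [|p] /= ->. Qed.

Lemma base_step vs p q : p <= q -> base vs q = base vs p \/
  exists b, [/\ base vs q = Some b, p < b & b <= q].
Proof.
elim: q => [|q ih]; first by rewrite leqn0 => /eqP->; left.
rewrite leq_eqVlt ltnS => /orP[/eqP->|pq]; first by left.
rewrite /=; case: ifP => h; first by right; exists q.+1.
by have [->|[b [e pb bq]]] := ih pq; [left|right; exists b; split=> //; apply: leqW].
Qed.

Section Terms.
Variables (sg ar : nat -> nat) (v : nat -> nat -> nat) (L : nat -> nat -> bool).
Variables (ch : nat -> seq nat) (x0 : nat).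

Definition point (w : seq nat) j : nat := nth 0 (x0 :: map qy w) j.

(* In [2^R], the variable number [size w] gets those points as exponents that
   belong to the variables not above it with respect to [L], where the point
   [point w j] belongs to the variable number [j]. *)
Definition exponents (w : seq nat) : seq nat :=
  select (point w) (fun j => L j (size w)) 0 (size w).+1.

Definition tel (w : seq nat) r c : nat := code [:: code (exponents w); code w; r; c].

Definition tbot c : nat := code [:: code [::]; code [::]; 0; c].

(** Together with [x0], a chain of length [k] provides [k + 1] points, which fits the path variables
    of term number [k + 1]. *)
Definition places s : seq nat := [seq v (size (ch s)).+1 i | i <- iota 0 (size (ch s)).+1].

(* The auxiliary variables of the term are put directly above the last
   distinguished variable before them. *)
Definition placement s p : nat :=
  if base (places s) p is Some b then
    let i := index b (places s) in tel (take i (ch s)) (last_change ch i s) (p - b)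
  else tbot p.

Definition arg s : seq nat := mkseq (placement s) (ar (size (ch s)).+1).

Definition dterm s : nat := npair (sg (size (ch s)).+1) (code (arg s)).

End Terms.

Lemma placement_ext v L ch ch' x0 s p : (forall t, t <= s -> ch' t = ch t) ->
  placement v L ch' x0 s p = placement v L ch x0 s p.
Proof.
move=> e; rewrite /placement /places e //; case: (base _ p) => // b.
by rewrite /= (last_change_ext _ e).
Qed.

Lemma dterm_ext sg ar v L ch ch' x0 s : (forall t, t <= s -> ch' t = ch t) ->
  dterm sg ar v L ch' x0 s = dterm sg ar v L ch x0 s.
Proof.
move=> e; rewrite /dterm /arg e //; congr (npair _ (code _)).
by apply: eq_mkseq => p; apply: placement_ext.
Qed.

Section Descent.
Variables (D : set nat) (hD : predilator D).
Variables (sg ar : nat -> nat) (v : nat -> nat -> nat) (L : nat -> nat -> bool).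
Hypothesis full_sg : forall i, full D (sg i) (ar i).
Hypothesis v_ar : forall i j, j < i -> v i j < ar i.
Hypothesis v_L : forall i j j', j < i -> j' < i -> (v i j <= v i j') = L j j'.
Hypothesis v_inj : forall i j j', j < i -> j' < i -> v i j = v i j' -> j = j'.
Hypothesis sg_lt : forall i i' j g h, j < i -> j < i' -> sorted ltn g ->
  size g = ar i -> sorted ltn h -> size h = ar i' ->
  (forall j', j' < j -> nth 0 g (v i j') = nth 0 h (v i' j')) ->
  nth 0 g (v i j) < nth 0 h (v i' j) -> ~ tle D (sg i') h (sg i) g.
Variable R : nat -> nat -> Prop.
Hypothesis hR : linear_order R.
Variables (ch : nat -> seq nat) (x0 : nat).
Hypothesis x0R : R x0 x0.
Hypothesis ch_path : forall s,
  path [rel x y | `[<strict R y x>]] x0 (map qy (ch s)).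

Local Notation pnt := (point x0).
Local Notation exps := (exponents L x0).
Local Notation elem := (tel L x0).

Lemma point_dec s i j : i < j -> j <= size (ch s) ->
  strict R (pnt (ch s) j) (pnt (ch s) i).
Proof.
have [_ anti tra _] := hR.
move=> ij js; have tr : transitive [rel x y | `[<strict R y x>]].
  move=> y x z /= /asboolP[r1 n1] /asboolP[r2 n2]; apply/asboolP.
  by split; [apply: tra r2 r1|move=> e; subst z; apply: n1; apply: anti].
have h := @sorted_ltn_nth _ _ tr 0 (x0 :: map qy (ch s)) (ch_path s) i j.
apply/asboolP; apply: h => //; rewrite inE /= size_map ltnS //.
exact: leq_trans (ltnW ij) js.
Qed.

Lemma point_fld s i : i <= size (ch s) -> R (pnt (ch s) i) (pnt (ch s) i).
Proof.
have [fld _ _ _] := hR; case: i => [|i] hi //.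
by have [h _] := point_dec (ltn0Sn i) hi; have [] := fld _ _ h.
Qed.

(** All sums become selections from one common list of points, as [lex_select] demands. *)
Lemma exponents_take s i : i <= size (ch s) -> exps (take i (ch s)) =
  select (pnt (ch s)) (fun j => (j <= i) && L j i) 0 (size (ch s)).+1.
Proof.
move=> hi; rewrite /exponents size_takel // /select.
have -> : iota 0 (size (ch s)).+1 = iota 0 i.+1 ++ iota i.+1 (size (ch s) - i).
  by rewrite -[RHS]/(iota 0 i.+1 ++ iota (0 + i.+1) (size (ch s) - i)) -iotaD; congr iota; lia.
rewrite filter_cat map_cat.
have -> : [seq j <- iota i.+1 (size (ch s) - i) | (j <= i) && L j i] = [::].
  apply/eqP; rewrite -size_eq0 size_filter -leqn0 leqNgt -has_count; apply/hasPn => p.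
  by rewrite mem_iota => /andP[ip _]; rewrite leqNgt ip.
rewrite cats0.
have -> : [seq j <- iota 0 i.+1 | L j i] = [seq j <- iota 0 i.+1 | (j <= i) && L j i].
  by apply: eq_in_filter => j; rewrite mem_iota ltnS => /andP[_ ->].
apply/eq_in_map => j; rewrite mem_filter => /andP[/andP[ji _] _].
case: j ji => [//|j] ji; rewrite /point /=.
by rewrite map_take nth_take.
Qed.

Lemma increasing_exponents s i : i <= size (ch s) ->
  increasing R (rev (exps (take i (ch s)))).
Proof.
move=> hi; rewrite exponents_take //; apply: increasing_select => //.
  by move=> j _; rewrite add0n ltnS; apply: point_fld.
by move=> j j' _ jj'; rewrite add0n ltnS; apply: point_dec.
Qed.

Lemma exponents_fld s i : i <= size (ch s) ->
  exp2 R (code (exps (take i (ch s)))) (code (exps (take i (ch s)))).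
Proof.
move=> hi; have h := increasing_exponents hi.
by exists (exps (take i (ch s))), (exps (take i (ch s))); split=> //; apply: lex_refl.
Qed.

(** Powers are chosen so that the sums reproduce the order [L] of the variables; index [i']
    witnesses that the two selections differ. *)
Lemma exponents_lt s i i' : i <= size (ch s) -> i' <= size (ch s) ->
  v (size (ch s)).+1 i < v (size (ch s)).+1 i' ->
  strict (exp2 R) (code (exps (take i (ch s)))) (code (exps (take i' (ch s)))).
Proof.
set k := size (ch s) => hi hi' lt.
pose P i j := (j <= i) && L j i.
have PE a j : a <= k -> j <= k -> P a j = (j <= a) && (v k.+1 j <= v k.+1 a).
  by move=> ha hj; rewrite /P v_L.
have ex : exists j, (j <= k) && (P i j != P i' j).
  exists i'; rewrite hi' !PE // !leqnn /= eqb_id.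
  by rewrite [v _ _ <= _]leqNgt lt andbF.
have [j [jk Pj nPj agr]] : exists j, [/\ j <= k, P i' j, ~~ P i j & forall a, a < j -> P i a = P i' a].
  case: (ex_minnP ex) => j /andP[jk ne] minj.
  have agr a : a < j -> P i a = P i' a.
    move=> aj; have ak := leq_trans (ltnW aj) jk.
    apply/eqP; apply: contraTT aj => ne'; rewrite -leqNgt.
    by apply: minj; rewrite ak.
  (* If the first difference [j] belonged to [i] only, then [j] would exceed [i'], where the
     selections already differ. *)
  exists j; case Pi: (P i j) ne; case Pi': (P i' j) => // _.
  move: Pi Pi'; rewrite !PE // => /andP[ji vji]; rewrite (leq_trans vji (ltnW lt)) andbT => ji'.
  have i'j : i' < j by rewrite ltnNge ji'.
  have := agr i' i'j; rewrite !PE // !leqnn /= [v _ _ <= _]leqNgt lt andbF //.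
have [l1 l2] := @lex_select R (pnt (ch s)) (P i) (P i') 0 k.+1
  (fun a b _ ab hb => point_dec ab (hb : b < k.+1))
  (ex_intro _ j (And5 (leq0n j) (jk : j < 0 + k.+1) Pj nPj (fun a _ => agr a))).
split; last by move/code_inj; rewrite !exponents_take.
exists (exps (take i (ch s))), (exps (take i' (ch s))).
split=> //; try exact: increasing_exponents.
by rewrite !exponents_take.
Qed.

Lemma exponents_neq0 s i : i <= size (ch s) -> exps (take i (ch s)) <> [::].
Proof.
move=> hi; rewrite exponents_take // => e.
have : pnt (ch s) i \in select (pnt (ch s)) (fun j => (j <= i) && L j i) 0 (size (ch s)).+1.
  by apply: map_f; rewrite mem_filter mem_iota /= leqnn -(@v_L i.+1) // leqnn ltnS.
by rewrite e.
Qed.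

Lemma tel_elt s i c : i <= size (ch s) ->
  target_elt R ch (elem (take i (ch s)) (last_change ch i s) c).
Proof.
move=> hi; have [_ vl] := last_changeP hi.
by split; rewrite /tel ?decode_code ?entryE ?decode_code //; apply: exponents_fld.
Qed.

Lemma tbot_elt c : target_elt R ch (tbot c).
Proof.
split; rewrite /tbot ?decode_code ?entryE ?decode_code //; last first.
  by rewrite /valid take0 eqxx /changed eqxx orbT.
by exists [::], [::]; split=> //; split.
Qed.

Local Notation pls := (places v ch).
Local Notation plm := (placement v L ch x0).
Local Notation args := (arg ar v L ch x0).

Lemma size_places s : size (pls s) = (size (ch s)).+1.
Proof. by rewrite size_map size_iota. Qed.

Lemma nth_places s i : i <= size (ch s) -> nth 0 (pls s) i = v (size (ch s)).+1 i.
Proof. by move=> hi; rewrite (nth_map 0) ?size_iota // nth_iota. Qed.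

Lemma uniq_places s : uniq (pls s).
Proof.
rewrite map_inj_in_uniq ?iota_uniq // => i j.
by rewrite !mem_iota => /andP[_ hi] /andP[_ hj]; apply: v_inj.
Qed.

Lemma index_places s b : b \in pls s -> index b (pls s) <= size (ch s) /\
  v (size (ch s)).+1 (index b (pls s)) = b.
Proof.
move=> hb; have hi : index b (pls s) <= size (ch s).
  by rewrite -ltnS -size_places index_mem.
by rewrite -nth_places // nth_index.
Qed.

Lemma placementP s p : target_elt R ch (plm s p).
Proof.
rewrite /placement; case e: (base _ p) => [b|]; last exact: tbot_elt.
by have [_ /index_places[hi _]] := base_in e; apply: tel_elt.
Qed.

(** Positions with a common base differ in the last component; otherwise the sums decide, positions
    without a base having the empty sum. *)
Lemma placement_lt s p q : p < q ->
  target R ch (plm s p) (plm s q) /\ plm s p <> plm s q.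
Proof.
move=> pq; have [ep eq] := (placementP s p, placementP s q).
have [e|[b [e pb bq]]] := base_step (pls s) (ltnW pq).
  move: ep eq; rewrite /placement e; case e': (base _ p) => [b|] ep eq.
    have [bp _] := base_in e'; split.
      by split=> //; rewrite /tel /tbot !entryE; right; split=> //; right; split=> //; right;
        split=> //; lia.
    by move/(congr1 (entry 3)); rewrite /tel /tbot !entryE; lia.
  split; last by move/(congr1 (entry 3)); rewrite /tel /tbot !entryE; lia.
  by split=> //; rewrite /tel /tbot !entryE; right; split=> //; right; split=> //; right;
    split=> //; lia.
have [_ bin] := base_in e; have [hi vi] := index_places bin.
suff lt : strict (exp2 R) (entry 0 (plm s p)) (entry 0 (plm s q)).
  by split; [split=> //; left|move=> e'; case: lt => _; apply; rewrite e'].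
move: eq; rewrite /placement e; case e': (base _ p) => [b'|] eq; rewrite /tel /tbot !entryE.
  have [bp' bin'] := base_in e'; have [hi' vi'] := index_places bin'.
  by apply: exponents_lt => //; rewrite vi vi'; apply: leq_ltn_trans pb.
split; last by move/code_inj => h; have := exponents_neq0 hi; rewrite -h.
exists [::], (exps (take (index b (pls s)) (ch s))).
by split=> //; apply: increasing_exponents.
Qed.

Lemma increasing_arg s : increasing (target R ch) (args s).
Proof.
split.
  apply/(uniqP 0) => p q; rewrite !inE size_mkseq => hp hq; rewrite !nth_mkseq // => e.
  by case: (ltngtP p q) => // /(placement_lt s)[_]; rewrite e.
move=> p q pq; rewrite size_mkseq => hq; have hp := leq_ltn_trans pq hq.
rewrite !nth_mkseq //; move: pq; rewrite leq_eqVlt => /orP[/eqP->|pq]; first exact/target_refl/placementP.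
by have [] := placement_lt s pq.
Qed.

Lemma Dbar_arg s : Dbar_elt D (target R ch) (sg (size (ch s)).+1) (args s).
Proof.
have [h1 h2] := full_sg (size (ch s)).+1; rewrite /Dbar_elt size_mkseq; split=> //.
exact: increasing_arg.
Qed.

Lemma nth_arg s i : i <= size (ch s) -> nth 0 (args s) (v (size (ch s)).+1 i) =
  elem (take i (ch s)) (last_change ch i s) 0.
Proof.
move=> hi; rewrite nth_mkseq ?v_ar // /placement.
have e := nth_places hi; have hs : i < size (pls s) by rewrite size_places.
rewrite base_mem -e ?mem_nth // index_uniq ?uniq_places //.
by rewrite subnn.
Qed.

(** Let [j] be the first index that changes at stage [s + 1]. Path variables before [j] keep their
    values. Variable [j] keeps its prefix but gets a later stage, which is lower in the target
    order, and by the path property it decides. *)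
Lemma dterm_desc s : strict (Dbar D (target R ch))
  (dterm sg ar v L ch x0 s.+1) (dterm sg ar v L ch x0 s).
Proof.
have hT := linear_target ch hR; have [_ anti _ _] := hT.
have [ia ib] := (increasing_arg s.+1, increasing_arg s).
have [g [h [sg' sh pt]]] := pat_exists hT ia ib.
apply/(Dbar_strict hD hT (Dbar_arg _) (Dbar_arg _) sg' sh pt).
have [sag sbh pp] := pt; rewrite !size_mkseq in sag sbh pp.
have [j [js js1 cj nc ej]] := first_change ch s.
have posa i : i <= size (ch s.+1) -> v (size (ch s.+1)).+1 i < ar (size (ch s.+1)).+1.
  by move=> hi; apply: v_ar.
have posb i : i <= size (ch s) -> v (size (ch s)).+1 i < ar (size (ch s)).+1.
  by move=> hi; apply: v_ar.
have refl i : i <= size (ch s) -> target R ch (nth 0 (args s) (v (size (ch s)).+1 i))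
    (nth 0 (args s) (v (size (ch s)).+1 i)).
  by move=> hi; apply: (increasing_refl ib); rewrite size_mkseq; apply: v_ar.
apply: (sg_lt (j := j)) => //.
  move=> j' jj'; have [_ _ _ e1 e2] := unchangedP (nc j' jj').
  have hj := leq_trans (ltnW jj') js; have hj1 := leq_trans (ltnW jj') js1.
  have [p1 p2] := pp _ _ (posa _ hj1) (posb _ hj).
  have e : nth 0 (args s.+1) (v (size (ch s.+1)).+1 j') = nth 0 (args s) (v (size (ch s)).+1 j').
    by rewrite !nth_arg // e1 e2.
  have := refl _ hj => r; rewrite e in p1 p2.
  by apply/eqP; rewrite eqn_leq; apply/andP; split; [apply/p1|apply/p2].
have [p1 p2] := pp _ _ (posa _ js1) (posb _ js).
rewrite ltnNge; apply/negP => /p2 r; rewrite !nth_arg // in r.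
have [le1 _] := last_changeP js.
have lt : last_change ch j s < last_change ch j s.+1 by rewrite /= cj.
have [_ _ h3] := r; rewrite /tel !entryE ej in h3.
by case: h3 => [[_]|[_]]; [apply|rewrite /= cj; lia].
Qed.

End Descent.

(** * Computability of the descent *)

Section Approximation.
Implicit Types A B : set nat.

Definition refuted B q m : bool := `[<B (npair (npair (qy q) (qn q)) m)>].

(** At stage [s], the claim that [qn q] witnesses the failure of the formula at [qy q] has been
    tested below [s]. *)
Definition cand A B s y q : bool :=
  `[<strict (coded_order A) (qy q) y>] && all (fun m => ~~ refuted B q m) (iota 0 s).

Definition approx A B x0 : nat -> seq nat := chain (cand A B) x0.

Lemma near_greedy A B s f y :
  near A B (fun A' B' => greedy (cand A' B') s f y = greedy (cand A B) s f y).
Proof.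
have cnd y' : near A B (fun A' B' => forall q, q < s -> cand A' B' s y' q = cand A B s y' q).
  apply: near_all => q _.
  have := near_and (near_strict A B (qy q) y')
    (near_all (n := s) (fun m _ => near_right A B (npair (npair (qy q) (qn q)) m))).
  apply: near_mono => A' B' [h1 h2]; rewrite /cand h1; congr (_ && _).
  by apply: eq_in_all => m; rewrite mem_iota => /andP[_ ms]; rewrite /refuted h2.
elim: f y => [|f ih] y; first exact: near_const.
have := near_and (cnd y) (near_all (n := s) (fun q _ => ih (qy q))).
apply: near_mono => A' B' [h1 h2] /=.
have -> : cands (cand A' B') s y = cands (cand A B) s y.
  by apply: eq_in_filter => q; rewrite mem_iota => /andP[_ qs]; apply: h1.
case e: (cands (cand A B) s y) => [|q l] //; congr (_ :: _); apply: h2.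
have : q \in cands (cand A B) s y by rewrite e mem_head.
by rewrite mem_filter mem_iota => /and3P[].
Qed.

Lemma near_approx A B x0 s : near A B (fun A' B' =>
  forall t, t <= s -> approx A' B' x0 t = approx A B x0 t).
Proof.
have := near_all (n := s.+1) (fun t _ => near_greedy A B t t x0).
by apply: near_mono.
Qed.

Lemma near_target_elt A B x0 x : near A B (fun A' B' =>
  target_elt (coded_order A') (approx A' B' x0) x =
  target_elt (coded_order A) (approx A B x0) x).
Proof.
have := near_and (near_exp2 A B (entry 0 x) (entry 0 x)) (near_approx A B x0 (entry 2 x)).
by apply: near_mono => A' B' [h1 h2]; rewrite /target_elt h1 (valid_ext _ h2).
Qed.

Lemma near_target A B x0 x y : near A B (fun A' B' =>
  target (coded_order A') (approx A' B' x0) x y =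
  target (coded_order A) (approx A B x0) x y).
Proof.
have := near_and (near_target_elt A B x0 x) (near_and (near_target_elt A B x0 y)
  (near_exp2 A B (entry 0 x) (entry 0 y))).
by apply: near_mono => A' B' [h1 [h2 h3]]; rewrite /target /strict h1 h2 h3.
Qed.

End Approximation.

Lemma npair_total z : (exists x y, z = npair x y) \/ (forall x y, z <> npair x y).
Proof.
case: (pselect (exists x y, z = npair x y)) => h; first by left.
by right=> x y e; apply: h; exists x, y.
Qed.

Lemma TI_of_path (D : set nat) : predilator D -> has_path D ->
  omega_entails RCA0 (fun M X => dilator_in M X -> Pi02_TI_star M) D.
Proof.
move=> hD [sg [ar [v [L [full_sg v_ar v_L v_inj sg_lt]]]]].
(* The path need not belong to the model; it is built into the functional and thus into the oracle.
   The starting point is an index, since it depends on the model. *)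
pose G (i : bool * nat) (A B : set nat) : set nat :=
  if i.1 then graph (dterm sg ar v L (approx A B i.2) i.2)
  else fun z => exists x y, z = npair x y /\ target (coded_order A) (approx A B i.2) x y.
have useG i A B z : near A B (fun A' B' => G i A' B' z <-> G i A B z).
  case: i => -[] x0; rewrite /G /=.
    have [[s [y ->]]|no] := npair_total z; last first.
      by apply: near_const => A' B'; split=> -[s _ e]; case: (no _ _ (esym e)).
    apply: near_mono (near_approx A B x0 s) => A' B' h.
    by rewrite !graphE (dterm_ext _ _ _ _ _ h).
  have [[x [y ->]]|no] := npair_total z; last first.
    by apply: near_const => A' B'; split=> -[x [y [e _]]]; case: (no x y).
  apply: near_mono (near_target A B x0 x y) => A' B' h.
  by split=> -[x' [y' [e]]]; case: (npair_inj e) => ? ?; subst x' y'; exists x, y;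
    split=> //; [rewrite -h|rewrite h].
have [Y2 hY2] := thin_oracle (fun _ : unit => entry 0).
have [Y hY] := join_oracle (use_oracle G) Y2.
exists Y => M hM _ MY [_ dil]; have [MY1 MY2] := hY M hM MY.
move=> A MA hA wf2 phi e E [theta bth ->] ME prog x xA.
apply: contrapT => nx.
pose B := matrix_set theta e E.
have MB : M B by apply: matrix_set_in.
have satE y : ~ sat (env_cons y e) E (FAll (FEx theta)) <->
    exists n, forall m, ~ B (npair (npair y n) m).
  split=> [ny|[n hn] h]; last by have [m hm] := h n; apply: (hn m); apply/matrix_setE.
  apply: contrapT => no; apply: ny => n; apply: contrapT => nm; apply: no.
  by exists n => m /matrix_setE h; apply: nm; exists m.
pose good y := coded_order A y y /\ ~ sat (env_cons y e) E (FAll (FEx theta)).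
have gx : good x by [].
have [fldA _ _ _] := hA.
have ok_anti s t y q : s <= t -> cand A B t y q -> cand A B s y q.
  move=> st /andP[h1 /allP h2]; rewrite /cand h1; apply/allP => m.
  by rewrite mem_iota => /andP[_ ms]; apply: h2; rewrite mem_iota (leq_trans ms).
(* Progressiveness gives a smaller counterexample, which is coded together with a witness of its
   failure. *)
have good_next y : good y -> exists q, forall s, cand A B s y q.
  move=> [yA ny]; have [y' lt ny'] : exists2 y', strict (coded_order A) y' y &
      ~ sat (env_cons y' e) E (FAll (FEx theta)).
    apply: contrapT => no; apply: ny; apply: prog => // y' lt.
    by apply: contrapT => ny'; apply: no; exists y'.
  have [n hn] := (satE y').1 ny'.
  exists (code [:: y'; n]) => s; rewrite /cand /refuted /qy /qn decode_code /=.
  apply/andP; split; first exact/asboolP.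
  by apply/allP => m _; apply/asboolP/hn.
have ok_good y q : (forall s, cand A B s y q) -> good (qy q).
  move=> h; split; first by have /andP[/asboolP[/fldA[]]] := h 0.
  apply/satE; exists (qn q) => m Bm; have /andP[_ /allP/(_ m)] := h m.+1.
  by rewrite mem_iota add0n ltnS leqnn => /(_ isT) /asboolP.
pose R := coded_order A; pose ch := approx A B x.
have MG i : M (G i A B).
  apply: (use_oracleP hM MY1) => // z; have [b hb] := useG i A B z.
  by exists b => A' B'; apply: hb.
have eT : coded_order (G (false, x) A B) = target R ch.
  apply/funext => y; apply/funext => z; apply/propext; rewrite /coded_order /G /=.
  split; last by move=> h; exists y, z.
  by move=> [y' [z' [/npair_inj[-> ->]]]].
have bnd w : exists b, forall r, valid ch w r -> r < b.
  exact: valid_bounded ok_anti good_next ok_good gx.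
have := dil _ (MG (false, x)); rewrite eT; apply.
- exact: linear_target.
- apply: (wf_target hA wf2 bnd) => f Mf dec.
  exact: (hY2 M hM MY2 tt f (exp2 R) 0 Mf wf2 dec).
exists (dterm sg ar v L ch x); first exact: MG (true, x).
apply: (@dterm_desc D hD sg ar v L) => // s.
by apply: greedy_path => y q /andP[].
Qed.

Theorem theorem3p11 (D : set nat) (hD : predilator D)
    (hwf : wf_in setT (Dbar D omega_squared)) :
  omega_entails RCA0 dilator_in D \/
  omega_entails RCA0 (fun M X => dilator_in M X -> Pi02_TI_star M) D.
Proof.
case: (pselect (has_path D)) => [path|nopath].
  by right; apply: TI_of_path.
by left; apply: dilator_of_no_path.
Qed.
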